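(* Let $M$ be a von Neumann algebra and let $\phi:M\to M$ be a UP map. Then the tail operator system $M_\infty$ contains the multiplicative core $C_\phi$. If, in addition, the asymptotic lift of $\phi$ embeds in $M$, then $M_\infty$ is a Jordan subalgebra of $M$ if and only if $M_\infty=C_\phi$.
   Context: A dual operator system is a self-adjoint weak$^*$-closed linear space of operators $M\subseteq\mathcal B(H)$ containing the identity $\mathbf 1$; its predual $M_*$ is identified with the weak$^*$-continuous linear functionals on $M$. Every von Neumann algebra is one. A UP map is a normal (weak$^*$-continuous), unit-preserving, positive linear map between dual operator systems. A UP automorphism is a bijective UP map of a dual operator system onto itself whose inverse is a UP map. $M^{\rm sa}$ denotes the real Banach space of self-adjoint elements of $M$, and $\mathrm{ball}_r X$ denotes the closed ball of radius $r$ (centered at $0$) of a normed space $X$. A reversible lift of a UP map $\phi:M\to M$ is a triple $(N,\alpha,E)$ consisting of a dual operator system $N$, a UP automorphism $\alpha:N\to N$, and a UP map $E:N\to M$ satisfying $E\circ\alpha=\phi\circ E$. It is nondegenerate if, for $y\in N$, $E(\alpha^{-n}(y))=0$ for all $n=0,1,2,\dots$ implies $y=0$. An asymptotic lift of $\phi$ is a nondegenerate reversible lift $(N,\alpha,E)$ such that $\|\rho\circ E\restriction_{N^{\rm sa}}\|=\lim_{k\to\infty}\|\rho\circ\phi^k\restriction_{M^{\rm sa}}\|$ for every $\rho\in M_*$. Every UP map has an asymptotic lift, unique up to isomorphism. The asymptotic lift $(N,\alpha,E)$ embeds in $M$ if $\|E(y)\|=\|y\|$ for every $y=y^*\in N$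 (this does not depend on the choice of asymptotic lift). The tail operator system is $M_\infty=\bigcup_{r>0}\bigcap_{n=1}^\infty\phi^n(\mathrm{ball}_r M)$. The Jordan product on $M$ is $x\circ y=\frac12(xy+yx)$; a Jordan subalgebra of $M$ is a linear subspace closed under it. The definite set of $\phi$ is $M_\phi=\{x\in M:\phi(x^*\circ x)=\phi(x)^*\circ\phi(x)\}$. Put $B_\phi=\{x\in M:\phi^n(x)\in M_\phi,\ n=0,1,2,\dots\}$. The multiplicative core of $\phi$ is $C_\phi=\bigcap_{n=1}^\infty\phi^n(B_\phi)$. *)

(* Defs.v *)
From HB Require Import structures.
From mathcomp Require Import all_boot all_order all_algebra.
From mathcomp Require Import sesquilinear complex.
From mathcomp Require Import all_classical all_reals all_analysis.

Set Implicit Arguments.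
Unset Strict Implicit.
Unset Printing Implicit Defensive.

Import Order.TTheory GRing.Theory Num.Theory Num.Def.
Import numFieldNormedType.Exports.

Local Open Scope classical_set_scope.
Local Open Scope ring_scope.

(* Complex Hilbert spaces; [inner] is linear in its first argument and
   conjugate-linear in its second one. *)
Structure hilbertType (R : realType) := HilbertType {
  hilbert_space :> completeNormedModType R[i];
  inner : {dot hilbert_space for conjC};
  normr_inner : forall u : hilbert_space, `|u| ^+ 2 = inner u u }.

(* In a normed module over R[i] the norm takes its values in R[i]; [rnorm] is
   the same norm, as an element of R. *)
Definition rnorm {R : realType} {V : normedModType R[i]} (v : V) : R :=
  complex.Re `|v|.

(* B(H), with its structures of vector space over R[i] and of ring (the product
   is the composition). *)
Section BoundedOperators.
Context {R : realType}.
Variable H : hilbertType R.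

Definition bounded_linear : {pred H -> H} :=
  fun f => `[< linear f /\ continuous f >].

Lemma bounded_linear_submod : submod_closed bounded_linear.
Proof.
split.
  apply/asboolP; split=> [a u v|]; last exact: cst_continuous.
  by rewrite scaler0 addr0.
move=> a f g /asboolP[fl fc] /asboolP[gl gc]; apply/asboolP; split.
  move=> b u v; rewrite !fctE fl gl !scalerDr !scalerA mulrC -!addrA.
  by congr (_ + _); rewrite addrCA.
by move=> u; apply: cvgD; [apply: cvgZl_tmp; exact: fc|exact: gc].
Qed.

HB.instance Definition _ :=
  GRing.isSubmodClosed.Build _ _ bounded_linear bounded_linear_submod.

Record bop := BOp { bop_fun :> H -> H; bopP : bop_fun \in bounded_linear }.

HB.instance Definition _ := [isSub for bop_fun].
HB.instance Definition _ := [Choice of bop by <:].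
HB.instance Definition _ := [SubChoice_isSubLmodule of bop by <:].

Fact bop_one_subproof : (id : H -> H) \in bounded_linear.
Proof. by apply/asboolP; split=> // u; exact: cvg_id. Qed.

Fact bop_mul_subproof (x y : bop) :
  ((x : H -> H) \o (y : H -> H)) \in bounded_linear.
Proof.
have /asboolP[xl xc] := bopP x; have /asboolP[yl yc] := bopP y.
apply/asboolP; split=> [a u v|u]; first by rewrite /= yl xl.
by apply: continuous_comp; [exact: yc|exact: xc].
Qed.

Definition bop_one : bop := BOp bop_one_subproof.
Definition bop_mul (x y : bop) : bop := BOp (bop_mul_subproof x y).

Fact bop_mulA : associative bop_mul.
Proof. by move=> x y z; apply: val_inj. Qed.
Fact bop_mul1 : left_id bop_one bop_mul.
Proof. by move=> x; apply: val_inj. Qed.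
Fact bop_mulr1 : right_id bop_one bop_mul.
Proof. by move=> x; apply: val_inj. Qed.
Fact bop_mulDl : left_distributive bop_mul +%R.
Proof. by move=> x y z; apply: val_inj. Qed.
Fact bop_mulDr : right_distributive bop_mul +%R.
Proof.
move=> x y z; apply: val_inj; apply/funext => u /=.
have /asboolP[xl _] := bopP x.
by have := xl 1 (y u) (z u); rewrite !scale1r.
Qed.

HB.instance Definition _ := GRing.Zmodule_isPzRing.Build bop
  bop_mulA bop_mul1 bop_mulr1 bop_mulDl bop_mulDr.

End BoundedOperators.

Section Operators.
Context {R : realType} {H : hilbertType R}.
Implicit Types (x y : bop H) (S : set (bop H)).

(* The adjoint exists and is unique by the Riesz representation theorem. *)
Definition adjoint x : bop H :=
  xget 0 [set y : bop H | forall u v : H, inner H (x u) v = inner H u (y v)].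

Definition selfadjoint x := adjoint x = x.

Definition positive_op x := forall u : H, 0 <= inner H (x u) u.

Definition opnorm x : R := sup [set rnorm (x u) | u in [set u : H | rnorm u <= 1]].

Definition jordan x y : bop H := 2%:R^-1 *: (x * y + y * x).

Definition linear_subspace S :=
  S 0 /\ forall (a : R[i]) x y, S x -> S y -> S (a *: x + y).

Definition sa_part S := [set x | S x /\ selfadjoint x].

Definition ball_in S (r : R) := [set x | S x /\ opnorm x <= r].

End Operators.

(* The weak* topology of B(H), as the dual of the trace class operators: the
   normal functionals are x |-> \sum_n <x (xi n), eta n> for square summable
   sequences xi and eta, and the topology is the initial one for them. *)
Section WeakStar.
Context {R : realType}.
Variable H : hilbertType R.

Definition l2seq :=
  {xi : nat -> H | cvgn (series (fun n => rnorm (xi n) ^+ 2))}.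

Definition normal_functionals (x : bop H) : {ptws l2seq * l2seq -> R[i]^o} :=
  fun p => limn (series (fun n =>
    inner H (x (sval p.1 n)) (sval p.2 n) : R[i]^o)).

Definition weak_star := initial_topology normal_functionals.

End WeakStar.

Section DualOperatorSystems.
Context {R : realType}.
Implicit Types H K : hilbertType R.

Definition dual_operator_system H (M : set (bop H)) :=
  [/\ linear_subspace M, M 1, forall x, M x -> M (adjoint x) &
      closed (M : set (weak_star H))].

Definition von_neumann_algebra H (M : set (bop H)) :=
  dual_operator_system M /\ forall x y, M x -> M y -> M (x * y).

(* Maps and functionals on a dual operator system N are represented by total
   functions on B(K), of which only the restriction to N matters. *)
Definition linear_on K (N : set (bop K)) (V : lmodType R[i])
    (f : bop K -> V) :=
  forall (a : R[i]) x y, N x -> N y -> f (a *: x + y) = a *: f x + f y.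

Definition UP_map K H (N : set (bop K)) (M : set (bop H))
    (E : bop K -> bop H) :=
  [/\ set_fun N M E, linear_on N E, E 1 = 1,
      forall y, N y -> positive_op y -> positive_op (E y) &
      {within (N : set (weak_star K)),
        continuous (E : weak_star K -> weak_star H)}].

Definition predual K (N : set (bop K)) (rho : bop K -> R[i]) :=
  linear_on N (rho : bop K -> R[i]^o) /\
  {within (N : set (weak_star K)),
    continuous (rho : weak_star K -> R[i]^o)}.

Definition norm_on_sa K (N : set (bop K)) (f : bop K -> R[i]) : R :=
  sup [set rnorm (f y : R[i]^o) | y in ball_in (sa_part N) 1].

Definition inverse_on K (N : set (bop K)) (alpha : bop K -> bop K) :
  bop K -> bop K := 'pinv_(fun=> 0) N alpha.

Definition UP_automorphism K (N : set (bop K)) (alpha : bop K -> bop K) :=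
  [/\ UP_map N N alpha, set_bij N N alpha & UP_map N N (inverse_on N alpha)].

Section Lifts.
Variables (H : hilbertType R) (M : set (bop H)) (phi : bop H -> bop H).
Variables (K : hilbertType R) (N : set (bop K)).
Variables (alpha : bop K -> bop K) (E : bop K -> bop H).

Definition reversible_lift :=
  [/\ dual_operator_system N, UP_automorphism N alpha, UP_map N M E &
      forall y, N y -> E (alpha y) = phi (E y)].

Definition nondegenerate :=
  forall y, N y -> (forall n, E (iter n (inverse_on N alpha) y) = 0) -> y = 0.

Definition asymptotic_lift :=
  [/\ reversible_lift, nondegenerate &
      forall rho, predual M rho ->
        norm_on_sa M (rho \o iter k phi) @[k --> \oo]
          --> norm_on_sa N (rho \o E)].

End Lifts.

(* Asymptotic lifts exist and are unique up to isomorphism, so that it does not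
   matter which one is used. *)
Definition asymptotic_lift_embeds H (M : set (bop H)) (phi : bop H -> bop H) :=
  exists (K : hilbertType R) (N : set (bop K))
      (alpha : bop K -> bop K) (E : bop K -> bop H),
    asymptotic_lift M phi N alpha E /\
    forall y, N y -> selfadjoint y -> opnorm (E y) = opnorm y.

Definition tail_system H (M : set (bop H)) (phi : bop H -> bop H) :=
  \bigcup_(r in [set r : R | 0 < r])
    \bigcap_(n in [set n | (0 < n)%N]) (iter n phi @` ball_in M r).

Definition jordan_subalgebra H (M S : set (bop H)) :=
  [/\ S `<=` M, linear_subspace S &
      forall x y, S x -> S y -> S (jordan x y)].

Definition definite_set H (M : set (bop H)) (phi : bop H -> bop H) :=
  [set x | M x /\
    phi (jordan (adjoint x) x) = jordan (adjoint (phi x)) (phi x)].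

Definition orbit_definite_set H (M : set (bop H)) (phi : bop H -> bop H) :=
  [set x | M x /\ forall n, definite_set M phi (iter n phi x)].

Definition multiplicative_core H (M : set (bop H)) (phi : bop H -> bop H) :=
  \bigcap_(n in [set n | (0 < n)%N]) (iter n phi @` orbit_definite_set M phi).

End DualOperatorSystems.

(* Main.v *)
Require Import Defs.
From HB Require Import structures.
From mathcomp Require Import all_boot all_order all_algebra.
From mathcomp Require Import sesquilinear complex ring lra.
From mathcomp Require Import all_classical all_reals all_analysis.

(** Why the theorem is true. Write [B] for the orbit definite set, [C] for the
    multiplicative core and [T] for the tail system.

    Kadison's inequality [phi (h ^ 2) >= phi h ^ 2] ([kadison]), applied to
    [t x + y] for all real [t], shows that an element [x] with equality satisfies
    [phi (jordan x y) = jordan (phi x) (phi y)] for every [y]. So the definite set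
    is a Jordan algebra ([definite_setP], [definite_set_jordan]), every power of
    [phi] is a Jordan homomorphism on [B], and [C] is a Jordan algebra.

    [C] is contained in [T]: an element of [C] has a lift in [B] under each
    [phi ^ n], and these lifts must be made bounded independently of [n]. For
    C*-algebras one would use functional calculus with a truncation function. Here
    explicit polynomials take its place: they are preserved by [phi ^ n] on [B],
    map the lift into the unit ball, and move a small element very little
    ([opnorm_clamp], [clamp_error]). The resulting approximate lifts yield exact
    ones because the image of the unit ball is weak* compact ([bounded_lift]).

    If [T = C], then [T] is a Jordan algebra because [C] is. Conversely, let
    [(N, alpha, E)] be an asymptotic lift with [E] isometric on self-adjoint
    elements. Since [E = phi ^ n E alpha ^ - n], the range of [E] lies in [T]; the
    norm formula of the asymptotic lift and separation of points from the compact
    convex set [E (ball)] give the reverse inclusion for self-adjoint elements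
    ([tail_sa_sub_E]). Suppose that [T] is a Jordan algebra; then [E] maps [N] onto
    [T]. A unital isometry reflects positivity, so [phi] restricts to a bijection
    of [T] whose inverse [E alpha^-1 E^-1] is positive and unital. Kadison's
    inequality holds on [T] for both maps, hence it is an equality there, and [T]
    is contained in [C] ([tail_sub_core]).

    Two tools are built for this. Positivity of polynomials in one operator is
    reduced to squares times linear factors, without square roots or a spectral
    theorem; through Bernstein polynomials it gives Kadison's inequality. The
    weak* topology is handled by real parts of the normal functionals [wfun p]:
    compactness of balls comes from ultrafilters and the Riesz representation
    ([compact_ball_sa]), and separation from minimising a finite sum of squares
    ([weak_star_separation]). *)

Set Implicit Arguments.
Unset Strict Implicit.
Unset Printing Implicit Defensive.

Import Order.TTheory GRing.Theory Num.Theory Num.Def.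
Import numFieldNormedType.Exports.

Local Open Scope classical_set_scope.
Local Open Scope ring_scope.

(** * The real inner product *)

Section ComplexNumbers.
Context {R : realType}.
Implicit Types (z : R[i]) (r : R).

Lemma conjCE z : conjC z = conjc z. Proof. by []. Qed.

Lemma ReD z z' : complex.Re (z + z') = complex.Re z + complex.Re z'.
Proof. by case: z; case: z'. Qed.

Lemma ReN z : complex.Re (- z) = - complex.Re z.
Proof. by case: z. Qed.

Lemma Re_realM r z : complex.Re (r%:C%C * z) = r * complex.Re z.
Proof. by case: z => a b /=; rewrite mul0r subr0. Qed.

Lemma Re_conj z : complex.Re (conjC z) = complex.Re z.
Proof. by rewrite conjCE; case: z. Qed.

Lemma ReX2 z : complex.Im z = 0 -> complex.Re (z ^+ 2) = complex.Re z ^+ 2.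
Proof. by case: z => a b /= ->; rewrite mul0r subr0. Qed.

Lemma normC_Re z : `|z| = (complex.Re `|z|)%:C%C.
Proof. by rewrite normc_def. Qed.

Lemma Re_norm_realC r : complex.Re `|r%:C%C : R[i]| = `|r|.
Proof. by rewrite normc_def /= expr0n /= addr0 sqrtr_sqr. Qed.

Lemma ge0_Re_Im z : (0 <= z) = (complex.Im z == 0) && (0 <= complex.Re z).
Proof. by rewrite lecE. Qed.

End ComplexNumbers.

Section RealForm.
Context {R : realType} {H : hilbertType R}.
Implicit Types (u v w : H) (a : R[i]) (r : R).

(** The real part of the inner product determines it, and turns [H] into a real
    Hilbert space; this keeps estimates within the ordered field [R]. *)
Definition rinner u v : R := complex.Re (inner H u v).

Lemma rinnerDl u v w : rinner (u + v) w = rinner u w + rinner v w.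
Proof. by rewrite /rinner linearDl ReD. Qed.

Lemma rinnerC u v : rinner u v = rinner v u.
Proof. by rewrite /rinner (hermC (inner H) u v) expr0 mul1r Re_conj. Qed.

Lemma rinnerDr u v w : rinner w (u + v) = rinner w u + rinner w v.
Proof. by rewrite !(rinnerC w) rinnerDl. Qed.

Lemma rinner_adj a u v : rinner (a *: u) v = rinner u (conjC a *: v).
Proof.
by rewrite /rinner linearZl_LR linearZr_LR /= conjCK.
Qed.

Lemma rinnerZl r u v : rinner (r%:C%C *: u) v = r * rinner u v.
Proof. by rewrite /rinner linearZl_LR /= -Re_realM. Qed.

Lemma rinnerZr r u v : rinner u (r%:C%C *: v) = r * rinner u v.
Proof. by rewrite rinnerC rinnerZl rinnerC. Qed.

Lemma rinnerNl u v : rinner (- u) v = - rinner u v.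
Proof. by rewrite /rinner linearNl ReN. Qed.

Lemma rinnerNr u v : rinner u (- v) = - rinner u v.
Proof. by rewrite rinnerC rinnerNl rinnerC. Qed.

Lemma rinnerBl u v w : rinner (u - v) w = rinner u w - rinner v w.
Proof. by rewrite rinnerDl rinnerNl. Qed.

Lemma rinner0l v : rinner 0 v = 0.
Proof. by rewrite -[0 in LHS](subrr v) rinnerBl subrr. Qed.

Lemma rinner0r v : rinner v 0 = 0.
Proof. by rewrite rinnerC rinner0l. Qed.

Lemma innerE u v :
  inner H u v = (rinner u v +i* rinner u ('i%C *: v))%C.
Proof.
rewrite /rinner linearZr_LR /= conjCE; case: (inner H u v) => a b /=.
by rewrite mul0r sub0r mulN1r opprK.
Qed.

Lemma rinner_norm u : rinner u u = rnorm u ^+ 2.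
Proof.
rewrite /rinner -normr_inner /rnorm ReX2 //.
by have := normr_ge0 u; rewrite ge0_Re_Im => /andP[/eqP].
Qed.

Lemma rnorm_ge0 {V : normedModType R[i]} (u : V) : 0 <= rnorm u.
Proof. by have := normr_ge0 u; rewrite ge0_Re_Im => /andP[]. Qed.

Lemma norm_rnorm {V : normedModType R[i]} (u : V) : `|u| = (rnorm u)%:C%C.
Proof.
rewrite /rnorm; have := normr_ge0 u; rewrite ge0_Re_Im.
by case: `|u| => a b /= /andP[/eqP-> _].
Qed.

Lemma rnormD {V : normedModType R[i]} (u v : V) :
  rnorm (u + v) <= rnorm u + rnorm v.
Proof. by have := ler_normD u v; rewrite !norm_rnorm -rmorphD /= lecR. Qed.

Lemma rnormZ {V : normedModType R[i]} a (u : V) :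
  rnorm (a *: u) = complex.Re `|a| * rnorm u.
Proof. by rewrite /rnorm normrZ [X in X * _]normC_Re Re_realM. Qed.

Lemma rnormZr {V : normedModType R[i]} r (u : V) :
  rnorm (r%:C%C *: u) = `|r| * rnorm u.
Proof. by rewrite rnormZ Re_norm_realC. Qed.

Lemma rnormN {V : normedModType R[i]} (u : V) : rnorm (- u) = rnorm u.
Proof. by rewrite /rnorm normrN. Qed.

Lemma rnorm0 {V : normedModType R[i]} : rnorm (0 : V) = 0.
Proof. by rewrite /rnorm normr0. Qed.

Lemma rnorm0_eq0 {V : normedModType R[i]} (u : V) : rnorm u = 0 -> u = 0.
Proof. by move=> u0; apply/normr0_eq0; rewrite norm_rnorm u0. Qed.

Lemma rinner_le u v : `|rinner u v| <= rnorm u * rnorm v.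
Proof.
have key (a b : R) : rinner (a%:C%C *: u + b%:C%C *: v)
    (a%:C%C *: u + b%:C%C *: v) =
    a ^+ 2 * rnorm u ^+ 2 + 2 * a * b * rinner u v + b ^+ 2 * rnorm v ^+ 2.
  rewrite rinnerDl !rinnerDr !rinnerZl !rinnerZr (rinnerC v u) !rinner_norm.
  ring.
have [u0|u0] := eqVneq (rnorm u) 0.
  by rewrite (rnorm0_eq0 u0) rinner0l normr0 rnorm0 mul0r.
have ugt0 : 0 < rnorm u by rewrite lt_neqAle eq_sym u0 rnorm_ge0.
have := key (- rinner u v) (rnorm u ^+ 2).
rewrite rinner_norm => e.
have : 0 <= rnorm u ^+ 2 * (rnorm u ^+ 2 * rnorm v ^+ 2 - rinner u v ^+ 2).
  have -> : rnorm u ^+ 2 * (rnorm u ^+ 2 * rnorm v ^+ 2 - rinner u v ^+ 2) =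
    (- rinner u v) ^+ 2 * rnorm u ^+ 2 +
      2 * - rinner u v * rnorm u ^+ 2 * rinner u v +
      (rnorm u ^+ 2) ^+ 2 * rnorm v ^+ 2 by ring.
  by rewrite -e sqr_ge0.
rewrite pmulr_rge0 ?exprn_gt0// subr_ge0 -exprMn.
rewrite -[X in X <= _]real_normK ?num_real// ler_sqr ?nnegrE //.
by rewrite mulr_ge0 ?rnorm_ge0.
Qed.

Lemma rinner_inj u v : (forall w, rinner u w = rinner v w) -> u = v.
Proof.
move=> uv; apply/eqP; rewrite -subr_eq0; apply/eqP/rnorm0_eq0.
by apply/eqP; rewrite -sqrf_eq0 -rinner_norm rinnerBl uv subrr.
Qed.

Lemma rnorm_le_rinner u (c : R) : 0 <= c ->
  (forall v, rinner u v <= c * rnorm v) -> rnorm u <= c.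
Proof.
move=> c0 /(_ u); rewrite rinner_norm expr2.
have [->//|u0] := eqVneq (rnorm u) 0.
by rewrite ler_pM2r// lt_neqAle eq_sym u0 rnorm_ge0.
Qed.

End RealForm.

(** * Riesz representation *)

Section Riesz.
Context {R : realType} {H : hilbertType R}.
Implicit Types (u v w : H) (a : R[i]) (r : R).

Lemma ltr_normC {V : normedModType R[i]} (u : V) (e : R) :
  (`|u| < e%:C%C) = (rnorm u < e).
Proof. by rewrite norm_rnorm ltcR. Qed.

Lemma parallelogram u v :
  rnorm (u + v) ^+ 2 + rnorm (u - v) ^+ 2 =
  2 * (rnorm u ^+ 2 + rnorm v ^+ 2).
Proof.
rewrite -!rinner_norm !(rinnerDl, rinnerDr, rinnerNl, rinnerNr) (rinnerC v u).
by ring.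
Qed.

Lemma rnorm_cauchy_cvg (u_ : nat -> H) :
  (forall e : R, 0 < e -> exists N, forall n m, (N <= n)%N -> (N <= m)%N ->
     rnorm (u_ n - u_ m) < e) ->
  exists w, forall e : R, 0 < e -> \forall n \near \oo, rnorm (w - u_ n) < e.
Proof.
move=> uC; have : cvg (u_ @ \oo).
  apply/cauchy_cvgP; apply: cauchy_exP => e e0.
  have eE : e = (complex.Re e)%:C%C.
    by case: e e0 => a b; rewrite ltcE /= => /andP[/eqP-> _].
  have re0 : 0 < complex.Re e by move: e0; rewrite ltcE => /andP[].
  have [N HN] := uC _ re0.
  exists (u_ N); exists N => // n /= Nn; rewrite -ball_normE /= eE ltr_normC.
  exact: HN.
move=> /cvg_ex[w uw]; exists w => e e0.
move/cvgrPdist_lt : uw => /(_ e%:C%C); rewrite ltcR => /(_ e0).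
by apply: filterS => n; rewrite ltr_normC.
Qed.

(** The representing vector minimises [|v|^2 - 2 g v]; a minimising sequence is
    Cauchy by the parallelogram law, and first-order optimality at its limit is
    the representation. *)
Lemma riesz (g : H -> R) (C : R) :
  (forall u v, g (u + v) = g u + g v) ->
  (forall r u, g (r%:C%C *: u) = r * g u) ->
  (forall u, `|g u| <= C * rnorm u) ->
  exists w, forall v, rinner w v = g v.
Proof.
move=> gD gZ gC; pose J v := rnorm v ^+ 2 - 2 * g v.
pose I := inf (range J).
have Jlb : has_lbound (range J).
  exists (- C ^+ 2) => _ [u _ <-]; rewrite /J.
  have := gC u; rewrite ler_norml => /andP[_ gu].
  have : 0 <= (rnorm u - C) ^+ 2 by rewrite sqr_ge0.
  nra.
have JI v : I <= J v by apply: ge_inf Jlb _ _; exists v.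
pose d (n : nat) : R := n.+1%:R^-1.
have d0 n : 0 < d n by rewrite invr_gt0.
have exv n : {v | J v < I + d n}.
  apply: cid; have [|_ [v _ <-] Jv] := @inf_adherent _ (range J) (d n) (d0 n).
    by split=> //; exists (J 0), 0.
  by exists v.
pose v_ n := sval (exv n).
have vP n : J (v_ n) < I + d n by rewrite /v_; case: (exv n).
have dto0 e : 0 < e -> exists N, forall n, (N <= n)%N -> d n < e.
  move=> e0; have [N _ HN] : \forall n \near \oo, d n < e.
    exact: (near_infty_natSinv_lt (PosNum e0)).
  by exists N => n; exact: HN.
have Jmid u v : J u + J v = 2 * J ((2^-1)%:C%C *: (u + v)) +
    rnorm (u - v) ^+ 2 / 2.
  rewrite /J gZ gD rnormZr exprMn real_normK ?num_real//.
  have := parallelogram u v; lra.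
have [|w wP] := rnorm_cauchy_cvg (u_ := v_).
  move=> e e0; have [N HN] := dto0 (e ^+ 2 / 4) ltac:(nra).
  exists N => n m Nn Nm.
  have := Jmid (v_ n) (v_ m); have := JI ((2^-1)%:C%C *: (v_ n + v_ m)).
  have := vP n; have := vP m; have := HN n Nn; have := HN m Nm.
  move=> dm dn Jm Jn Jh Je.
  have : rnorm (v_ n - v_ m) ^+ 2 < e ^+ 2 by lra.
  by rewrite ltr_sqr ?nnegrE ?rnorm_ge0// ltW.
exists w => v; apply/eqP; rewrite -subr_eq0; apply/eqP.
set D := rinner w v - g v.
(* the slope of J at w in the direction v is squeezed to 0 *)
have key t e : 0 < e -> 0 <= 2 * t * D + t ^+ 2 * rnorm v ^+ 2 + e.
  move=> e0.
  have A0 : 0 < 1 + 2 * `|t| * rnorm v.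
    by rewrite ltr_wpDr// !mulr_ge0// rnorm_ge0.
  have [N1 HN1] := dto0 (e / 2) ltac:(lra).
  have [N2 _ HN2] := wP (e / 2 / (1 + 2 * `|t| * rnorm v))
    (ltac:(by rewrite !divr_gt0)).
  pose n := maxn N1 N2.
  have dn := HN1 n (leq_maxl _ _).
  have /= wn := HN2 n (leq_maxr _ _).
  have := vP n; have := JI (v_ n + t%:C%C *: v).
  rewrite /J gD gZ -!rinner_norm !(rinnerDl, rinnerDr) !(rinnerZl, rinnerZr).
  rewrite (rinnerC v) => h1 h2.
  have h3 : `|t * rinner (w - v_ n) v| <= `|t| * rnorm (w - v_ n) * rnorm v.
    by rewrite normrM -mulrA ler_wpM2l// rinner_le.
  have h4 : 2 * `|t| * rnorm v * rnorm (w - v_ n) <= e / 2.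
    have := rnorm_ge0 (w - v_ n).
    by move: wn; rewrite ltr_pdivlMr//; lra.
  move: h3; rewrite rinnerBl ler_norml => /andP[h3 _].
  rewrite /D; lra.
have [//|D0] := eqVneq D 0.
pose q := rnorm v ^+ 2 + 1.
have q0 : 0 < q by rewrite ltr_wpDl// sqr_ge0.
have e0 : 0 < D ^+ 2 / q / 2 by rewrite !divr_gt0// exprn_even_gt0.
have := key (- D / q) _ e0.
have -> : 2 * (- D / q) * D + (- D / q) ^+ 2 * rnorm v ^+ 2 + D ^+ 2 / q / 2 =
   - (D ^+ 2 / q / 2) - (D / q) ^+ 2.
  have -> : rnorm v ^+ 2 = q - 1 by rewrite addrK.
  by field; rewrite gt_eqF.
have := sqr_ge0 (D / q); lra.
Qed.

End Riesz.

(** * Bounded operators and adjoints *)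

Section BoundedOps.
Context {R : realType} {H : hilbertType R}.
Implicit Types (u v w : H) (a : R[i]) (r : R) (x y : bop H).

Lemma bopDE x y u : (x + y) u = x u + y u. Proof. by []. Qed.
Lemma bopNE x u : (- x) u = - x u. Proof. by []. Qed.
Lemma bopZE a x u : (a *: x) u = a *: x u. Proof. by []. Qed.
Lemma bopME x y u : (x * y) u = x (y u). Proof. by []. Qed.
Lemma bop1E u : (1 : bop H) u = u. Proof. by []. Qed.
Lemma bop0E u : (0 : bop H) u = 0. Proof. by []. Qed.

Definition bopE := (bopDE, bopNE, bopZE, bopME, bop1E, bop0E).

Lemma bop_linear x : linear x.
Proof. by have /asboolP[] := bopP x. Qed.

Lemma bopD x u v : x (u + v) = x u + x v.
Proof. by have := bop_linear x 1 u v; rewrite !scale1r. Qed.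

Lemma bop0 x : x 0 = 0.
Proof.
by have /eqP := bopD x 0 0; rewrite addr0 addrC -subr_eq subrr => /eqP.
Qed.

Lemma bopZ x a u : x (a *: u) = a *: x u.
Proof. by have := bop_linear x a u 0; rewrite bop0 !addr0. Qed.

Lemma bopN x u : x (- u) = - x u.
Proof. by rewrite -scaleN1r bopZ scaleN1r. Qed.

Lemma bop_ext x y : (forall u v, rinner (x u) v = rinner (y u) v) -> x = y.
Proof.
move=> xy; apply: val_inj; apply/funext => u /=.
by apply: rinner_inj => v; exact: xy.
Qed.

Lemma mk_bop (f : H -> H) (C : R) : linear f ->
  (forall u, rnorm (f u) <= C * rnorm u) -> {x : bop H | forall u, x u = f u}.
Proof.
move=> fl fC; have fP : f \in @bounded_linear R H.
  apply/asboolP; split=> // u; apply/cvgrPdist_lt => e e0.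
  have eE : e = (complex.Re e)%:C%C.
    by case: e e0 => b c; rewrite ltcE /= => /andP[/eqP-> _].
  have re0 : 0 < complex.Re e by move: e0; rewrite ltcE => /andP[].
  have d0 : 0 < complex.Re e / (`|C| + 1) by rewrite divr_gt0// ltr_wpDl.
  have : \forall t \near u, `|u - t| < (complex.Re e / (`|C| + 1))%:C%C.
    by apply: (@cvgr_dist_lt _ _ _ (nbhs u) _ id u) => //; rewrite ltcR.
  apply: filterS => t; rewrite ltr_normC eE ltr_normC => ut.
  have -> : f u - f t = f (u - t).
    rewrite -[u in LHS](subrK t) -[f (u - t + t)]scale1r -{1}[u - t]scale1r.
    by rewrite fl !scale1r addrK.
  apply: le_lt_trans (fC _) _; rewrite ltr_pdivlMr ?ltr_wpDl// in ut.
  have := rnorm_ge0 (u - t); have := ler_norm C; nra.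
by exists (BOp fP).
Qed.

Lemma bop_bounded x : exists2 C : R, 0 <= C & forall u, rnorm (x u) <= C * rnorm u.
Proof.
have /asboolP[_ /(_ 0)] := bopP x.
move=> /cvgrPdist_lt /(_ 1%:C%C); rewrite ltcR => /(_ ltr01).
move=> /nbhs_normP[e /= e0 He].
have eE : e = (complex.Re e)%:C%C.
  by case: e e0 {He} => b c; rewrite ltcE /= => /andP[/eqP-> _].
have re0 : 0 < complex.Re e by move: e0; rewrite ltcE => /andP[].
set d := complex.Re e in eE re0.
exists (2 / d); first by rewrite divr_ge0// ltW.
move=> u; have [u0|u0] := eqVneq (rnorm u) 0.
  by rewrite (rnorm0_eq0 u0) bop0 rnorm0 mulr0.
have ugt0 : 0 < rnorm u by rewrite lt_neqAle eq_sym u0 rnorm_ge0.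
have := He ((d / 2 / rnorm u)%:C%C *: u).
rewrite /ball_ /= eE sub0r normrN ltr_normC rnormZr ger0_norm; last first.
  by rewrite !divr_ge0// ltW.
rewrite divfK// bop0 sub0r ltr_normC rnormN bopZ rnormZr => /(_ ltac:(lra)).
rewrite ger0_norm; last by rewrite !divr_ge0// ltW.
rewrite mulrAC ltr_pdivrMr// mul1r => h.
have -> : 2 / d * rnorm u = rnorm u / (d / 2) by field; rewrite gt_eqF.
by rewrite ler_pdivlMr ?divr_gt0// mulrC ltW.
Qed.

Lemma opnorm_has_sup x :
  has_sup [set rnorm (x u) | u in [set u : H | rnorm u <= 1]].
Proof.
split; first by exists (rnorm (x 0)), 0 => //=; rewrite rnorm0.
have [C C0 xC] := bop_bounded x.
exists C => _ [u /= u1 <-]; apply: le_trans (xC u) _.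
by rewrite -[leRHS]mulr1 ler_wpM2l.
Qed.

Lemma opnorm_ge0 x : 0 <= opnorm x.
Proof.
apply: le_trans (rnorm_ge0 (x 0)) _; apply: ub_le_sup.
  by case: (opnorm_has_sup x).
by exists 0 => //=; rewrite rnorm0.
Qed.

Lemma rnorm_bop x u : rnorm (x u) <= opnorm x * rnorm u.
Proof.
have [u0|u0] := eqVneq (rnorm u) 0.
  by rewrite (rnorm0_eq0 u0) bop0 rnorm0 mulr0.
have ugt0 : 0 < rnorm u by rewrite lt_neqAle eq_sym u0 rnorm_ge0.
rewrite -ler_pdivrMr//; apply: ub_le_sup; first by case: (opnorm_has_sup x).
exists ((rnorm u)^-1%:C%C *: u) => /=.
  by rewrite rnormZr ger0_norm ?invr_ge0 ?rnorm_ge0// mulVf.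
by rewrite bopZ rnormZr ger0_norm ?invr_ge0 ?rnorm_ge0// mulrC.
Qed.

Lemma opnorm_le x (C : R) : 0 <= C ->
  (forall u, rnorm (x u) <= C * rnorm u) -> opnorm x <= C.
Proof.
move=> C0 xC; apply: ge_sup; first by case: (opnorm_has_sup x).
move=> _ [u /= u1 <-]; apply: le_trans (xC u) _.
by rewrite -[leRHS]mulr1 ler_wpM2l.
Qed.

Lemma rinner_bop_le x u v :
  `|rinner (x u) v| <= opnorm x * rnorm u * rnorm v.
Proof.
apply: le_trans (rinner_le _ _) _.
by rewrite ler_wpM2r ?rnorm_ge0// rnorm_bop.
Qed.

Lemma opnormD x y : opnorm (x + y) <= opnorm x + opnorm y.
Proof.
apply: opnorm_le => [|u]; first by rewrite addr_ge0 ?opnorm_ge0.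
rewrite bopE (le_trans (rnormD _ _))// mulrDl lerD//; exact: rnorm_bop.
Qed.

Lemma opnormZ a x : opnorm (a *: x) <= complex.Re `|a| * opnorm x.
Proof.
have a0 : 0 <= complex.Re `|a|.
  by have := normr_ge0 a; rewrite ge0_Re_Im => /andP[].
apply: opnorm_le => [|u]; first by rewrite mulr_ge0 ?opnorm_ge0.
by rewrite bopE rnormZ -mulrA ler_wpM2l// rnorm_bop.
Qed.

Lemma opnormZr r x : opnorm (r%:C%C *: x) <= `|r| * opnorm x.
Proof. by have := opnormZ r%:C%C x; rewrite Re_norm_realC. Qed.

Lemma opnormM x y : opnorm (x * y) <= opnorm x * opnorm y.
Proof.
apply: opnorm_le => [|u]; first by rewrite mulr_ge0 ?opnorm_ge0.
rewrite bopE (le_trans (rnorm_bop _ _))// -mulrA.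
by rewrite ler_wpM2l ?opnorm_ge0// rnorm_bop.
Qed.

Lemma opnorm0 : opnorm (0 : bop H) = 0.
Proof.
apply/le_anti; rewrite opnorm_ge0 andbT.
by apply: opnorm_le => // u; rewrite bopE rnorm0 mul0r.
Qed.

(** Each [l u] is represented by a vector. Since [l] is only the real part of a
    sesquilinear form, linearity in the first argument is expressed by moving the
    scalar to the second one. *)
Lemma bop_of_form (l : H -> H -> R) (C : R) : 0 <= C ->
  (forall a u u' v, l (a *: u + u') v = l u (conjC a *: v) + l u' v) ->
  (forall u v v', l u (v + v') = l u v + l u v') ->
  (forall r u v, l u (r%:C%C *: v) = r * l u v) ->
  (forall u v, `|l u v| <= C * rnorm u * rnorm v) ->
  exists2 x : bop H, forall u v, rinner (x u) v = l u v & opnorm x <= C.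
Proof.
move=> C0 ll lD lZ lC.
have ex u : {w | forall v, rinner w v = l u v}.
  by apply: cid; apply: (riesz (lD u)) (fun r => lZ r u) (lC u).
pose f u := sval (ex u).
have fE u v : rinner (f u) v = l u v by rewrite /f; case: (ex u).
have fC u : rnorm (f u) <= C * rnorm u.
  apply: rnorm_le_rinner => [|v]; first by rewrite mulr_ge0 ?rnorm_ge0.
  by rewrite fE (le_trans (ler_norm _)).
have [|x xf] := @mk_bop f C _ fC.
  move=> a u v; apply: rinner_inj => w.
  by rewrite rinnerDl rinner_adj !fE ll.
exists x => [u v|]; first by rewrite xf fE.
by apply: opnorm_le => // u; rewrite xf.
Qed.

Lemma adjoint_subproof x :
  exists y : bop H, forall u v, inner H (x u) v = inner H u (y v).
Proof.
have [||||y yE _] := @bop_of_form (fun v u => rinner (x u) v) _ (opnorm_ge0 x).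
- move=> a u u' v; rewrite rinnerDr; congr (_ + _).
  by rewrite bopZ rinnerC rinner_adj rinnerC.
- by move=> u v v'; rewrite bopD rinnerDl.
- by move=> r u v; rewrite bopZ rinnerZl.
- by move=> u v; rewrite mulrAC rinner_bop_le.
exists y => u v.
have E u' v' : rinner (x u') v' = rinner u' (y v') by rewrite -yE rinnerC.
by rewrite innerE [in RHS]innerE -bopZ -!E.
Qed.

Lemma adjointP x u v : rinner (x u) v = rinner u (adjoint x v).
Proof.
rewrite /rinner; congr complex.Re; rewrite /adjoint.
case: xgetP => [y _ yP|]; first exact: yP.
by have [y yP] := adjoint_subproof x => /(_ y).
Qed.

Lemma adjoint_unique x y :
  (forall u v, rinner (x u) v = rinner u (y v)) -> adjoint x = y.
Proof.
by move=> xy; apply: bop_ext => u v; rewrite rinnerC -adjointP xy rinnerC.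
Qed.

Lemma adjointD x y : adjoint (x + y) = adjoint x + adjoint y.
Proof.
by apply: adjoint_unique => u v; rewrite !bopE rinnerDl rinnerDr -!adjointP.
Qed.

Lemma adjointZ a x : adjoint (a *: x) = conjC a *: adjoint x.
Proof.
apply: adjoint_unique => u v.
by rewrite !bopE rinner_adj adjointP bopZ.
Qed.

Lemma adjointZr r x : adjoint (r%:C%C *: x) = r%:C%C *: adjoint x.
Proof. by rewrite adjointZ conjCE conjc_real. Qed.

Lemma adjointN x : adjoint (- x) = - adjoint x.
Proof.
by apply: adjoint_unique => u v; rewrite !bopE rinnerNl rinnerNr -!adjointP.
Qed.

Lemma adjointM x y : adjoint (x * y) = adjoint y * adjoint x.
Proof. by apply: adjoint_unique => u v; rewrite !bopE !adjointP. Qed.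

Lemma adjointK x : adjoint (adjoint x) = x.
Proof.
by apply: adjoint_unique => u v; rewrite rinnerC -adjointP rinnerC.
Qed.

Lemma adjoint1 : adjoint 1 = 1 :> bop H.
Proof. by apply: adjoint_unique. Qed.

Lemma adjoint0 : adjoint 0 = 0 :> bop H.
Proof. by apply: adjoint_unique => u v; rewrite !bopE rinner0l rinner0r. Qed.

Lemma opnorm_adjoint x : opnorm (adjoint x) <= opnorm x.
Proof.
apply: opnorm_le => [|u]; first exact: opnorm_ge0.
apply: rnorm_le_rinner => [|v]; first by rewrite mulr_ge0 ?opnorm_ge0 ?rnorm_ge0.
rewrite rinnerC -adjointP mulrAC (le_trans (ler_norm _))//.
exact: rinner_bop_le.
Qed.

End BoundedOps.

(** * Self-adjoint and positive operators *)

(** Real multiples of the identity; the annotation says which ring [1] belongs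
    to. *)
Notation "r %:S" := (r%:C%C *: (1 : bop _)) (at level 1, left associativity,
  format "r %:S") : ring_scope.

Section SelfAdjoint.
Context {R : realType} {H : hilbertType R}.
Implicit Types (u v w : H) (a : R[i]) (r : R) (x y h c : bop H).

Lemma selfadjointP x :
  selfadjoint x <-> forall u v, rinner (x u) v = rinner u (x v).
Proof.
split; first by move=> xsa u v; rewrite adjointP xsa.
exact: adjoint_unique.
Qed.

Lemma selfadjointD x y : selfadjoint x -> selfadjoint y -> selfadjoint (x + y).
Proof. by rewrite /selfadjoint adjointD => -> ->. Qed.

Lemma selfadjointN x : selfadjoint x -> selfadjoint (- x).
Proof. by rewrite /selfadjoint adjointN => ->. Qed.

Lemma selfadjointB x y : selfadjoint x -> selfadjoint y -> selfadjoint (x - y).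
Proof. by move=> xsa ysa; apply/selfadjointD/selfadjointN. Qed.

Lemma selfadjointZ r x : selfadjoint x -> selfadjoint (r%:C%C *: x).
Proof. by rewrite /selfadjoint adjointZr => ->. Qed.

Lemma selfadjoint1 : selfadjoint (1 : bop H).
Proof. exact: adjoint1. Qed.

Lemma selfadjoint0 : selfadjoint (0 : bop H).
Proof. exact: adjoint0. Qed.

Lemma selfadjoint_conj x c :
  selfadjoint x -> selfadjoint c -> selfadjoint (c * x * c).
Proof. by rewrite /selfadjoint !adjointM => -> ->; rewrite mulrA. Qed.

Lemma selfadjointX x n : selfadjoint x -> selfadjoint (x ^+ n).
Proof.
move=> xsa; elim: n => [|n IH]; first by rewrite expr0; exact: selfadjoint1.
by rewrite /selfadjoint exprS adjointM IH xsa -exprSr exprS.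
Qed.

Lemma bopZl a x y : (a *: x) * y = a *: (x * y).
Proof. exact: val_inj. Qed.

Lemma bopZr a x y : x * (a *: y) = a *: (x * y).
Proof. by apply: val_inj; apply/funext => u /=; rewrite bopZ. Qed.

Lemma selfadjoint_jordan x y :
  selfadjoint x -> selfadjoint y -> selfadjoint (jordan x y).
Proof.
move=> xsa ysa; rewrite /selfadjoint /jordan adjointZ adjointD !adjointM.
rewrite xsa ysa addrC; suff -> : conjC (2%:R^-1 : R[i]) = 2%:R^-1 by [].
by rewrite fmorphV rmorph_nat.
Qed.

Lemma inv2E : 2%:R^-1 = (2^-1)%:C%C :> R[i].
Proof. by rewrite rmorphV /= ?unitfE ?pnatr_eq0// rmorph_nat. Qed.

Lemma double_scaler2 x : (2^-1)%:C%C *: (x + x) = x.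
Proof.
by rewrite -mulr2n -[x *+ 2]scaler_nat scalerA -inv2E mulVf ?scale1r.
Qed.

Lemma jordan_sq x : jordan x x = x ^+ 2.
Proof. by rewrite /jordan inv2E double_scaler2. Qed.

(** Over the complex numbers a positive quadratic form forces self-adjointness,
    by polarisation. *)
Lemma positive_opP x : positive_op x <->
  selfadjoint x /\ forall u, 0 <= rinner (x u) u.
Proof.
have ii : forall u, 'i%C *: ('i%C *: u) = - u :> H.
  by move=> u; rewrite scalerA -expr2 sqr_i scaleN1r.
have iadj : forall u v, rinner ('i%C *: u) v = - rinner u ('i%C *: v).
  move=> u v; rewrite rinner_adj -rinnerNr; congr rinner.
  rewrite -scaleNr conjCE; congr (_ *: _).
  by apply/eqP; rewrite eq_complex/= oppr0 !eqxx.
split=> [xpos|[/selfadjointP xsa xpos] u]; last first.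
  rewrite innerE ge0_Re_Im /= xpos andbT.
  have : rinner (x u) ('i%C *: u) = - rinner (x u) ('i%C *: u).
    by rewrite {1}xsa bopZ rinnerC iadj.
  by move=> /eqP; rewrite -addr_eq0 -mulr2n mulrn_eq0 => /eqP->.
have [B P] : (forall u, rinner (x u) ('i%C *: u) = 0) /\
    forall u, 0 <= rinner (x u) u.
  by split=> u; have := xpos u; rewrite innerE ge0_Re_Im /= => /andP[/eqP].
split=> //; apply/selfadjointP => u v.
have A w : rinner (x u) ('i%C *: w) = - rinner (x w) ('i%C *: u).
  have := B (u + w); rewrite bopD scalerDr rinnerDl !rinnerDr !B addr0 add0r.
  by move=> /eqP; rewrite addr_eq0 => /eqP.
have := A (- ('i%C *: v)); rewrite scalerN ii opprK => ->.
by rewrite bopN rinnerNl opprK bopZ iadj ii rinnerNr opprK rinnerC.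
Qed.

Lemma positive_selfadjoint x : positive_op x -> selfadjoint x.
Proof. by move=> /positive_opP[]. Qed.

Lemma positive_rinner x u : positive_op x -> 0 <= rinner (x u) u.
Proof. by move=> /positive_opP[_]; apply. Qed.

Lemma positiveD x y : positive_op x -> positive_op y -> positive_op (x + y).
Proof.
move=> /positive_opP[xsa x0] /positive_opP[ysa y0]; apply/positive_opP; split.
  exact: selfadjointD.
by move=> u; rewrite bopE rinnerDl addr_ge0.
Qed.

Lemma positiveZ r x : 0 <= r -> positive_op x -> positive_op (r%:C%C *: x).
Proof.
move=> r0 /positive_opP[xsa x0]; apply/positive_opP; split.
  exact: selfadjointZ.
by move=> u; rewrite bopE rinnerZl mulr_ge0.
Qed.

Lemma positive1 : positive_op (1 : bop H).
Proof.
apply/positive_opP; split; first exact: selfadjoint1.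
by move=> u; rewrite bopE rinner_norm sqr_ge0.
Qed.

Lemma positive0 : positive_op (0 : bop H).
Proof.
apply/positive_opP; split; first exact: selfadjoint0.
by move=> u; rewrite bopE rinner0l.
Qed.

Lemma positive_conj x c :
  positive_op x -> selfadjoint c -> positive_op (c * x * c).
Proof.
move=> /positive_opP[xsa x0] csa; apply/positive_opP; split.
  exact: selfadjoint_conj.
by move=> u; rewrite !bopE; have /selfadjointP -> := csa; exact: x0.
Qed.

Lemma positive_sq x : selfadjoint x -> positive_op (x ^+ 2).
Proof. by move=> /(positive_conj positive1); rewrite mulr1 expr2. Qed.

Lemma positive_sum (I : Type) (s : seq I) (P : pred I) (F : I -> bop H) :
  (forall i, P i -> positive_op (F i)) -> positive_op (\sum_(i <- s | P i) F i).
Proof.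
by move=> F0; elim/big_ind: _ => //; [exact: positive0|exact: positiveD].
Qed.

Lemma positive_le0_eq0 x : positive_op x -> positive_op (- x) -> x = 0.
Proof.
move=> /positive_opP[/selfadjointP xsa x0] nx0.
have Q u : rinner (x u) u = 0.
  apply/le_anti; rewrite x0 andbT -oppr_ge0 -rinnerNl.
  exact: (positive_rinner u nx0).
apply: bop_ext => u v; rewrite bopE rinner0l.
have := Q (u + v); rewrite bopD rinnerDl !rinnerDr !Q addr0 add0r.
rewrite (xsa v) (rinnerC v) -mulr2n => /eqP.
by rewrite mulrn_eq0 => /eqP.
Qed.

(** This removes the error terms of order [1 / n] that approximation by
    polynomials and rescaling leave behind. *)
Lemma positive_archimedean x y :
  selfadjoint x -> (forall n : nat, positive_op (x + (n.+1%:R^-1)%:C%C *: y)) ->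
  positive_op x.
Proof.
move=> xsa xy; apply/positive_opP; split=> // u.
rewrite leNgt; apply/negP => xu.
have h n : 0 <= rinner (x u) u + n.+1%:R^-1 * rinner (y u) u.
  by have := positive_rinner u (xy n); rewrite !bopE rinnerDl rinnerZl.
have y0 : 0 < rinner (y u) u by have := h 0%N; rewrite invr1; lra.
have e0 : 0 < - rinner (x u) u / rinner (y u) u.
  by rewrite divr_gt0// oppr_gt0.
have [N _ HN] := near_infty_natSinv_lt (PosNum e0).
have := HN N (leqnn N); rewrite /= ltr_pdivlMr// => hN.
by have := h N; set z := _^-1 in hN *; lra.
Qed.

End SelfAdjoint.

(** * Real polynomial calculus *)

Section PolynomialCalculus.
Context {R : realType} {H : hilbertType R}.
Implicit Types (u v w : H) (a : R[i]) (r : R) (x y h c : bop H) (p q : {poly R}).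

(** Unlike [bop H], polynomials form a commutative ring: identities between
    polynomials in one operator are proved there and transported by the morphism
    [peval h]. *)
Definition peval h p : bop H := \sum_(i < size p) (p`_i)%:C%C *: h ^+ i.

Lemma pevalE h p n : (size p <= n)%N ->
  peval h p = \sum_(i < n) (p`_i)%:C%C *: h ^+ i.
Proof.
move=> pn; rewrite /peval -!(big_mkord xpredT (fun i => (p`_i)%:C%C *: h ^+ i)).
rewrite [RHS](big_cat_nat (leq0n (size p)) pn) /=.
rewrite [X in _ = _ + X]big_nat_cond [X in _ = _ + X]big1 ?addr0//.
by move=> i /andP[/andP[pi _] _]; rewrite nth_default// scale0r.
Qed.

Lemma peval_is_zmod_morphism h : zmod_morphism (peval h).
Proof.
move=> p q; pose n := maxn (size p) (size q).
rewrite (@pevalE h p n) ?leq_maxl// (@pevalE h q n) ?leq_maxr//.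
rewrite (@pevalE h (p - q) n); last first.
  by rewrite (leq_trans (size_polyD _ _))// size_polyN.
rewrite -sumrB; apply: eq_bigr => i _.
by rewrite coefB rmorphB scalerBl.
Qed.

HB.instance Definition _ (h : bop H) :=
  GRing.isZmodMorphism.Build {poly R} (bop H) (peval h) (peval_is_zmod_morphism h).

Lemma pevalC h r : peval h r%:P = r%:S.
Proof.
by rewrite (@pevalE _ _ 1) ?size_polyC ?leq_b1// big_ord1 coefC expr0.
Qed.

Lemma pevalMX h p : peval h (p * 'X) = peval h p * h.
Proof.
rewrite (@pevalE _ _ (size p).+1); last first.
  by rewrite (leq_trans (size_polyMleq _ _))// size_polyX addn2.
rewrite big_ord_recl coefMX /= scale0r add0r /peval mulr_suml.
by apply: eq_bigr => i _; rewrite coefMX/= exprSr bopZl.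
Qed.

Lemma pevalZ h r p : peval h (r *: p) = r%:C%C *: peval h p.
Proof.
rewrite (@pevalE _ _ (size p)) ?size_scale_leq//.
by rewrite scaler_sumr; apply: eq_bigr => i _; rewrite coefZ rmorphM scalerA.
Qed.

Lemma pevalX1 h : peval h 'X = h.
Proof. by rewrite -['X]mul1r pevalMX pevalC scale1r mul1r. Qed.

Lemma peval_comm h p : peval h p * h = h * peval h p.
Proof.
rewrite /peval mulr_suml mulr_sumr; apply: eq_bigr => i _.
by rewrite bopZr bopZl -exprS exprSr.
Qed.

Lemma peval_is_monoid_morphism h : monoid_morphism (peval h).
Proof.
split; first by rewrite pevalC scale1r.
move=> p q; elim/poly_ind: p => [|p r IH]; first by rewrite !(mul0r, raddf0).
rewrite mulrDl !raddfD /= mulrDl; congr (_ + _).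
  by rewrite mulrAC !pevalMX IH -mulrA peval_comm mulrA.
by rewrite mul_polyC pevalZ pevalC bopZl mul1r.
Qed.

HB.instance Definition _ (h : bop H) :=
  GRing.isMonoidMorphism.Build {poly R} (bop H) (peval h)
    (peval_is_monoid_morphism h).

Lemma peval_selfadjoint h p : selfadjoint h -> selfadjoint (peval h p).
Proof.
move=> hsa; rewrite /peval; elim/big_ind: _; first exact: selfadjoint0.
  exact: selfadjointD.
by move=> i _; apply/selfadjointZ/selfadjointX.
Qed.

Lemma positive_pevalM2 h p q : selfadjoint h -> positive_op (peval h p) ->
  positive_op (peval h (q ^+ 2 * p)).
Proof.
move=> hsa p0; have -> : q ^+ 2 * p = q * p * q by ring.
rewrite !rmorphM /=.
by apply: positive_conj => //; exact: peval_selfadjoint.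
Qed.

(** Even powers are conjugations by self-adjoint operators, which reduces to
    exponents at most 1, and [X (1 - X) = X ^ 2 (1 - X) + (1 - X) ^ 2 X]. Thus no
    square root is needed to multiply these commuting positive operators. *)
Lemma positive_peval_bernstein h i j : positive_op h -> positive_op (1 - h) ->
  positive_op (peval h ('X ^+ i * (1 - 'X) ^+ j)).
Proof.
move=> h0 h1; have hsa := positive_selfadjoint h0.
have p1 : positive_op (peval h 1) by rewrite rmorph1; exact: positive1.
have pX : positive_op (peval h 'X) by rewrite pevalX1.
have pY : positive_op (peval h (1 - 'X)) by rewrite rmorphB rmorph1 /= pevalX1.
have pXY : positive_op (peval h ('X * (1 - 'X))).
  have -> : 'X * (1 - 'X) = 'X ^+ 2 * (1 - 'X) + (1 - 'X) ^+ 2 * 'X :> {poly R}.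
    by ring.
  by rewrite rmorphD; apply: positiveD; apply: positive_pevalM2.
rewrite -(odd_double_half i) -(odd_double_half j) !exprD -!mul2n !(mulnC 2).
rewrite !exprM.
have -> : 'X ^+ odd i * ('X ^+ i./2) ^+ 2 *
    ((1 - 'X) ^+ odd j * ((1 - 'X) ^+ j./2) ^+ 2) =
  ('X ^+ i./2 * (1 - 'X) ^+ j./2) ^+ 2 *
    ('X ^+ odd i * (1 - 'X) ^+ odd j) :> {poly R} by ring.
apply: positive_pevalM2 => //.
by case: (odd i); case: (odd j); rewrite ?expr0 ?expr1 ?mulr1 ?mul1r.
Qed.

End PolynomialCalculus.

(** * Order and norm *)

Section OrderAndNorm.
Context {R : realType} {H : hilbertType R}.
Implicit Types (u v w : H) (a : R[i]) (r : R) (x y h c : bop H).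

Lemma opnorm_sq_le h r : 0 <= r -> selfadjoint h ->
  positive_op ((r ^+ 2)%:S - h ^+ 2) -> opnorm h <= r.
Proof.
move=> r0 hsa hr; apply: opnorm_le => // u.
rewrite -(@ler_pXn2r _ 2) ?nnegrE ?rnorm_ge0 ?mulr_ge0 ?rnorm_ge0//.
have := positive_rinner u hr.
rewrite !bopE rinnerBl rinnerZl rinner_norm.
have /selfadjointP -> := hsa.
by rewrite rinner_norm subr_ge0 exprMn.
Qed.

(** [r ^ 2 - h ^ 2] is positive, because [2 r] times it is the sum of a conjugate
    of [r - h] and a conjugate of [r + h]. *)
Lemma opnorm_le_positive h r : 0 < r ->
  positive_op (r%:S - h) -> positive_op (r%:S + h) ->
  opnorm h <= r.
Proof.
move=> r0 hm hp.
have hsa : selfadjoint h.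
  have -> : h = (r%:S + h) - r%:S by rewrite addrAC subrr add0r.
  apply: selfadjointB; first exact: positive_selfadjoint.
  by apply: selfadjointZ; exact: selfadjoint1.
apply: opnorm_sq_le => //; first exact: ltW.
have pm : positive_op (peval h (r%:P - 'X)) by rewrite rmorphB /= pevalC pevalX1.
have pp : positive_op (peval h (r%:P + 'X)) by rewrite rmorphD /= pevalC pevalX1.
have := positiveD (positive_pevalM2 (r%:P + 'X) hsa pm)
  (positive_pevalM2 (r%:P - 'X) hsa pp).
have k0 : 0 <= (2 * r)^-1 by rewrite invr_ge0 mulr_ge0// ltW.
move=> /(positiveZ k0).
rewrite -rmorphD -pevalZ.
have -> : (r%:P + 'X) ^+ 2 * (r%:P - 'X) + (r%:P - 'X) ^+ 2 * (r%:P + 'X) =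
   (2 * r) *: ((r ^+ 2)%:P - 'X ^+ 2).
  by rewrite -mul_polyC polyC_exp polyCM polyC_natr; ring.
rewrite scalerA mulVf ?mulf_neq0 ?gt_eqF// scale1r rmorphB /= pevalC.
by rewrite [peval h ('X ^+ 2)]rmorphXn /= pevalX1.
Qed.

Lemma positive_opnorm h r : selfadjoint h -> opnorm h <= r ->
  positive_op (r%:S - h).
Proof.
move=> hsa hr; apply/positive_opP; split.
  by apply: selfadjointB => //; apply/selfadjointZ/selfadjoint1.
move=> u; rewrite !bopE rinnerBl rinnerZl rinner_norm subr_ge0.
apply: le_trans (ler_norm _) _; apply: le_trans (rinner_bop_le _ _ _) _.
by rewrite -mulrA -expr2 ler_wpM2r// sqr_ge0.
Qed.

Lemma opnormN x : opnorm (- x) = opnorm x.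
Proof.
by rewrite /opnorm; congr sup; apply: eq_imagel => u _; rewrite bopE rnormN.
Qed.

Lemma positive_opnormD h r : selfadjoint h -> opnorm h <= r ->
  positive_op (r%:S + h).
Proof.
move=> hsa hr; rewrite -[h]opprK; apply: positive_opnorm.
  exact: selfadjointN.
by rewrite opnormN.
Qed.

Lemma opnorm_eq0 x : opnorm x = 0 -> x = 0.
Proof.
move=> x0; apply: bop_ext => u v; rewrite bopE rinner0l.
by have := rinner_bop_le x u v; rewrite x0 !mul0r normr_le0 => /eqP.
Qed.

Lemma opnorm1 : opnorm (1 : bop H) <= 1.
Proof. by apply: opnorm_le => // u; rewrite bopE mul1r. Qed.

Lemma opnormX x n : opnorm (x ^+ n) <= opnorm x ^+ n.
Proof.
elim: n => [|n IH]; first exact: opnorm1.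
by rewrite !exprS (le_trans (opnormM _ _))// ler_wpM2l ?opnorm_ge0.
Qed.

Definition re_op x := (2^-1)%:C%C *: (x + adjoint x).
Definition im_op x := (2^-1)%:C%C *: ('i%C *: (adjoint x - x)).

Lemma conj_i : conjC 'i%C = - 'i%C :> R[i].
Proof. by rewrite conjCE; apply/eqP; rewrite eq_complex/= oppr0 !eqxx. Qed.

Lemma selfadjoint_re x : selfadjoint (re_op x).
Proof. by apply: selfadjointZ; rewrite /selfadjoint adjointD adjointK addrC. Qed.

Lemma selfadjoint_im x : selfadjoint (im_op x).
Proof.
apply: selfadjointZ; rewrite /selfadjoint adjointZ adjointD adjointN adjointK.
by rewrite conj_i scaleNr -scalerN opprB.
Qed.

Lemma re_imE x : x = re_op x + 'i%C *: im_op x.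
Proof.
have e : 'i%C * ((2^-1)%:C%C * 'i%C) = - (2^-1)%:C%C :> R[i].
  by rewrite mulrCA -expr2 sqr_i mulrN1.
rewrite /im_op [_%:C%C *: (_ *: _)]scalerA [_ *: (_ *: (adjoint x - x))]scalerA.
rewrite e scaleNr -scalerN -scalerDr opprB addrACA.
by rewrite subrr addr0 double_scaler2.
Qed.

Lemma adjoint_decomp x y : selfadjoint x -> selfadjoint y ->
  adjoint (x + 'i%C *: y) = x - 'i%C *: y.
Proof.
by rewrite /selfadjoint adjointD adjointZ conj_i scaleNr => -> ->.
Qed.


Lemma norm_i : `|'i%C| = 1 :> R[i].
Proof. by rewrite normc_def /= expr0n expr1n add0r sqrtr1. Qed.

Lemma opnorm_half x y (r : R) : opnorm x <= r -> opnorm y <= r ->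
  opnorm ((2^-1)%:C%C *: (x + y)) <= r.
Proof.
move=> xr yr; apply: le_trans (opnormZr _ _) _.
rewrite ger0_norm ?invr_ge0// ler_pdivrMl// mulr_natl mulr2n.
exact: le_trans (opnormD _ _) (lerD _ _).
Qed.

Lemma opnorm_re x : opnorm (re_op x) <= opnorm x.
Proof. by apply: opnorm_half => //; exact: opnorm_adjoint. Qed.

Lemma opnorm_im x : opnorm (im_op x) <= opnorm x.
Proof.
have inorm y : opnorm ('i%C *: y) <= opnorm y.
  by have := opnormZ 'i%C y; rewrite norm_i /= mul1r.
rewrite /im_op scalerDr; apply: opnorm_half.
  exact: le_trans (inorm _) (opnorm_adjoint x).
by rewrite (le_trans (inorm _))// opnormN.
Qed.

End OrderAndNorm.

(** * Positive unital maps *)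

Section Subspaces.
Context {R : realType} {H : hilbertType R} (S : set (bop H)).
Hypothesis S_lin : linear_subspace S.
Implicit Types (a : R[i]) (x y h : bop H).

Lemma subspace0 : S 0. Proof. by case: S_lin. Qed.

Lemma subspaceD x y : S x -> S y -> S (x + y).
Proof. by case: S_lin => _ SP Sx Sy; rewrite -[x]scale1r; exact: SP. Qed.

Lemma subspaceZ a x : S x -> S (a *: x).
Proof. by case: S_lin => S0 SP Sx; rewrite -[a *: x]addr0; exact: SP. Qed.

Lemma subspaceN x : S x -> S (- x).
Proof. by rewrite -scaleN1r; exact: subspaceZ. Qed.

Lemma subspaceB x y : S x -> S y -> S (x - y).
Proof. by move=> Sx Sy; apply/subspaceD/subspaceN. Qed.

Lemma subspace_peval h p : (forall n, S (h ^+ n)) -> S (peval h p).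
Proof.
move=> Sh; rewrite /peval; elim/big_ind: _; first exact: subspace0.
  exact: subspaceD.
by move=> i _; apply/subspaceZ/Sh.
Qed.

Lemma subspace_re x : S x -> S (adjoint x) -> S (re_op x).
Proof. by move=> Sx Sa; apply/subspaceZ/subspaceD. Qed.

Lemma subspace_im x : S x -> S (adjoint x) -> S (im_op x).
Proof. by move=> Sx Sa; apply/subspaceZ/subspaceZ/subspaceB. Qed.

Context {V : lmodType R[i]} (f : bop H -> V).
Hypothesis f_lin : linear_on S f.

Lemma linear_on0 : f 0 = 0.
Proof.
have := f_lin (-1) subspace0 subspace0.
by rewrite scaler0 addr0 scaleN1r addNr.
Qed.

Lemma linear_onD x y : S x -> S y -> f (x + y) = f x + f y.
Proof. by move=> Sx Sy; have := f_lin 1 Sx Sy; rewrite !scale1r. Qed.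

Lemma linear_onZ a x : S x -> f (a *: x) = a *: f x.
Proof.
by move=> Sx; have := f_lin a Sx subspace0; rewrite linear_on0 !addr0.
Qed.

Lemma linear_onN x : S x -> f (- x) = - f x.
Proof. by move=> Sx; rewrite -[- x]scaleN1r linear_onZ// scaleN1r. Qed.

Lemma linear_onB x y : S x -> S y -> f (x - y) = f x - f y.
Proof.
by move=> Sx Sy; rewrite linear_onD ?linear_onN//; exact: subspaceN.
Qed.

End Subspaces.

(** Normality and the target system are left out of [UP_map]: the inverse of
    [phi] on the tail system is only known to satisfy these conditions. *)
Definition positive_unital {R : realType} {H K : hilbertType R}
    (S : set (bop H)) (f : bop H -> bop K) :=
  [/\ linear_on S f, f 1 = 1 &
      forall x, S x -> positive_op x -> positive_op (f x)].

Section PositiveUnital.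
Context {R : realType} {H K : hilbertType R}.
Variables (S : set (bop H)) (f : bop H -> bop K).
Hypotheses (S_lin : linear_subspace S) (S1 : S 1).
Hypothesis f_pu : positive_unital S f.
Implicit Types (a : R[i]) (r : R) (x y h : bop H) (p q : {poly R}).

Let f_lin : linear_on S f. Proof. by case: f_pu. Qed.
Let f1 : f 1 = 1. Proof. by case: f_pu. Qed.
Let f_pos x : S x -> positive_op x -> positive_op (f x).
Proof. by case: f_pu => _ _; apply. Qed.

Lemma pu_scalar r : f r%:S = r%:S.
Proof. by rewrite (linear_onZ S_lin f_lin)// f1. Qed.

(** [x + opnorm x] is positive, hence so is its image, and positive operators are
    self-adjoint. *)
Lemma pu_selfadjoint x : S x -> selfadjoint x -> selfadjoint (f x).
Proof.
move=> Sx xsa; have Ss : S (opnorm x)%:S by exact: (subspaceZ S_lin).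
have := f_pos (subspaceD S_lin Ss Sx) (positive_opnormD xsa (lexx _)).
move=> /positive_selfadjoint; rewrite (linear_onD f_lin)// pu_scalar => sa.
rewrite -[f x](addKr (opnorm x)%:S); apply: selfadjointD => //.
exact/selfadjointN/selfadjointZ/selfadjoint1.
Qed.

Lemma pu_opnorm x : S x -> selfadjoint x -> opnorm (f x) <= opnorm x.
Proof.
move=> Sx xsa; apply/ler_addgt0Pr => e e0.
have r0 : 0 < opnorm x + e by rewrite ltr_wpDl// opnorm_ge0.
have xr : opnorm x <= opnorm x + e by rewrite lerDl ltW.
have Ss : S (opnorm x + e)%:S by exact: (subspaceZ S_lin).
apply: opnorm_le_positive => //.
  rewrite -pu_scalar -(linear_onB S_lin f_lin)//; apply: f_pos.
    exact: (subspaceB S_lin).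
  exact: positive_opnorm.
rewrite -pu_scalar -(linear_onD f_lin)//; apply: f_pos.
  exact: (subspaceD S_lin).
exact: positive_opnormD.
Qed.

Section Adjoint.
Variable x : bop H.
Hypotheses (Sx : S x) (Sa : S (adjoint x)).

Let Sr : S (re_op x). Proof. exact: subspace_re. Qed.
Let Si : S (im_op x). Proof. exact: subspace_im. Qed.

Lemma pu_re_im : f x = f (re_op x) + 'i%C *: f (im_op x).
Proof.
rewrite {1}[x]re_imE (linear_onD f_lin)//; last exact: (subspaceZ S_lin).
by rewrite (linear_onZ S_lin f_lin 'i%C).
Qed.

Lemma pu_adjoint : f (adjoint x) = adjoint (f x).
Proof.
have [rsa isa] := (selfadjoint_re x, selfadjoint_im x).
rewrite pu_re_im adjoint_decomp; try exact: pu_selfadjoint.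
rewrite [x in LHS]re_imE adjoint_decomp//.
rewrite (linear_onB S_lin f_lin)//; last exact: (subspaceZ S_lin).
by rewrite (linear_onZ S_lin f_lin 'i%C).
Qed.

Lemma pu_re : f (re_op x) = re_op (f x).
Proof.
rewrite (linear_onZ S_lin f_lin); last exact: (subspaceD S_lin).
by rewrite (linear_onD f_lin)// pu_adjoint.
Qed.

Lemma pu_im : f (im_op x) = im_op (f x).
Proof.
rewrite (linear_onZ S_lin f_lin); last exact/(subspaceZ S_lin)/(subspaceB S_lin).
rewrite (linear_onZ S_lin f_lin); last exact: (subspaceB S_lin).
by rewrite (linear_onB S_lin f_lin)// pu_adjoint.
Qed.

Lemma pu_opnorm2 : opnorm (f x) <= 2 * opnorm x.
Proof.
rewrite pu_re_im; apply: le_trans (opnormD _ _) _; rewrite mulr_natl mulr2n.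
apply: lerD.
  by apply: le_trans (pu_opnorm _ (selfadjoint_re x)) (opnorm_re x).
have := opnormZ 'i%C (f (im_op x)); rewrite norm_i /= mul1r => h.
apply: le_trans h _.
by apply: le_trans (pu_opnorm _ (selfadjoint_im x)) (opnorm_im x).
Qed.

End Adjoint.

Section Polynomials.
Variable h : bop H.
Hypothesis Sh : forall n, S (h ^+ n).

Let Sp p : S (peval h p). Proof. exact: subspace_peval. Qed.

Lemma pu_pevalD p q : f (peval h (p + q)) = f (peval h p) + f (peval h q).
Proof. by rewrite rmorphD /= (linear_onD f_lin). Qed.

Lemma pu_pevalZ r p : f (peval h (r *: p)) = r%:C%C *: f (peval h p).
Proof. by rewrite pevalZ (linear_onZ S_lin f_lin). Qed.

Lemma pu_peval_sum (I : Type) (s : seq I) (F : I -> {poly R}) :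
  f (peval h (\sum_(i <- s) F i)) = \sum_(i <- s) f (peval h (F i)).
Proof.
elim: s => [|i s IH]; first by rewrite !big_nil raddf0 (linear_on0 S_lin f_lin).
by rewrite !big_cons pu_pevalD IH.
Qed.

End Polynomials.

End PositiveUnital.

(** * Kadison's inequality *)

Section Bernstein.
Context {R : realType}.

(** The exponents [(i, n - i)] of the Bernstein polynomials of degree [n], each
    listed as often as it occurs in the expansion of ['X + (1 - 'X)] to the
    power [n]; the binomial coefficients are thus replaced by repetitions. *)
Fixpoint bernstein n : seq (nat * nat) :=
  if n is n'.+1 then
    [seq (ij.1, ij.2.+1) | ij <- bernstein n'] ++
    [seq (ij.1.+1, ij.2) | ij <- bernstein n']
  else [:: (0%N, 0%N)].

Definition bpoly (ij : nat * nat) : {poly R} := 'X ^+ ij.1 * (1 - 'X) ^+ ij.2.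

Lemma bernsteinS n (F : nat * nat -> {poly R}) :
  \sum_(ij <- bernstein n.+1) F ij =
  \sum_(ij <- bernstein n) (F (ij.1, ij.2.+1) + F (ij.1.+1, ij.2)).
Proof. by rewrite /= big_cat !big_map big_split. Qed.

Lemma bernstein_moments n :
  [/\ \sum_(ij <- bernstein n) bpoly ij = 1,
      \sum_(ij <- bernstein n) ij.1%:R * bpoly ij = n%:R * 'X &
      \sum_(ij <- bernstein n) ij.1%:R ^+ 2 * bpoly ij =
        n%:R ^+ 2 * 'X ^+ 2 + n%:R * ('X * (1 - 'X))].
Proof.
elim: n => [|n [m0 m1 m2]].
  rewrite !big_cons !big_nil /bpoly /=; split; ring.
have bl ij : bpoly (ij.1, ij.2.+1) = bpoly ij * (1 - 'X).
  by rewrite /bpoly exprSr mulrA.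
have br ij : bpoly (ij.1.+1, ij.2) = bpoly ij * 'X.
  by rewrite /bpoly exprSr mulrAC.
rewrite !bernsteinS; split.
- rewrite -[RHS]m0; apply: eq_bigr => ij _; rewrite bl br; ring.
- transitivity (\sum_(ij <- bernstein n) (ij.1%:R * bpoly ij + bpoly ij * 'X)).
    by apply: eq_bigr => ij _; rewrite bl br /= -natr1; ring.
  rewrite big_split /= m1 -mulr_suml m0 -natr1; ring.
- transitivity (\sum_(ij <- bernstein n) (ij.1%:R ^+ 2 * bpoly ij +
     ((ij.1%:R * bpoly ij) * (2 * 'X) + bpoly ij * 'X))).
    by apply: eq_bigr => ij _; rewrite bl br /= -natr1; ring.
  rewrite !big_split /= m2 -!mulr_suml m1 m0 -natr1; ring.
Qed.

End Bernstein.

Section Kadison.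
Context {R : realType} {H K : hilbertType R}.
Variables (S : set (bop H)) (f : bop H -> bop K).
Hypotheses (S_lin : linear_subspace S) (S1 : S 1).
Hypothesis f_pu : positive_unital S f.
Implicit Types (a : R[i]) (r : R) (x y h : bop H) (p q : {poly R}).

Let f_lin : linear_on S f. Proof. by case: f_pu. Qed.
Let f1 : f 1 = 1. Proof. by case: f_pu. Qed.
Let f_pos x : S x -> positive_op x -> positive_op (f x).
Proof. by case: f_pu => _ _; apply. Qed.

(** If the positive [A i] sum to [1], and [c] is the mean of the [l i] for these
    weights, the variance is [\sum_i (l i - c) * A i * (l i - c)]. *)
Lemma operator_variance (I : Type) (s : seq I) (l : I -> R) (A : I -> bop K) c :
  (forall i, positive_op (A i)) -> \sum_(i <- s) A i = 1 ->
  \sum_(i <- s) (l i)%:C%C *: A i = c ->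
  positive_op (\sum_(i <- s) (l i ^+ 2)%:C%C *: A i - c ^+ 2).
Proof.
move=> A0 A1 Ac.
have csa : selfadjoint c.
  rewrite -Ac; elim/big_ind: _; first exact: selfadjoint0.
    exact: selfadjointD.
  by move=> i _; apply/selfadjointZ/positive_selfadjoint.
have -> : \sum_(i <- s) (l i ^+ 2)%:C%C *: A i - c ^+ 2 =
    \sum_(i <- s) ((l i)%:S - c) * A i * ((l i)%:S - c).
  transitivity (\sum_(i <- s) ((l i ^+ 2)%:C%C *: A i
     - c * ((l i)%:C%C *: A i) - ((l i)%:C%C *: A i) * c + c * A i * c)).
    rewrite !big_split /= !sumrN -!mulr_suml -!mulr_sumr Ac A1 mulr1 expr2.
    by rewrite subrK.
  apply: eq_bigr => i _.
  rewrite mulrBr !mulrBl !(bopZl, bopZr) mul1r !mulr1 scalerA -rmorphM.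
  by rewrite -expr2 opprB addrA addrAC.
apply: positive_sum => i _; apply: positive_conj => //.
by apply: selfadjointB => //; apply/selfadjointZ/selfadjoint1.
Qed.

Hypothesis S_pow : forall h, S h -> selfadjoint h -> forall n, S (h ^+ n).

Lemma kadison01 h : S h -> positive_op h -> positive_op (1 - h) ->
  positive_op (f (h ^+ 2) - f h ^+ 2).
Proof.
move=> Sh h0 h1; have hsa := positive_selfadjoint h0.
have Shn := S_pow Sh hsa.
have Sp p : S (peval h p) by exact: subspace_peval.
have fD := pu_pevalD S_lin f_pu Shn; have fZ := pu_pevalZ S_lin f_pu Shn.
have fS := pu_peval_sum S_lin f_pu Shn.
have fX : f (peval h 'X) = f h by rewrite pevalX1.
apply: (@positive_archimedean _ _ _ (f (peval h ('X * (1 - 'X))))).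
  apply: selfadjointB; last apply: selfadjointX.
    by apply: (pu_selfadjoint S_lin S1 f_pu) => //; exact: selfadjointX.
  exact: (pu_selfadjoint S_lin S1 f_pu).
move=> n; have [m0 m1 m2] := @bernstein_moments R n.+1.
have n0 : n.+1%:R != 0 :> R by rewrite pnatr_eq0.
have := @operator_variance _ (bernstein n.+1)
  (fun ij => n.+1%:R^-1 * ij.1%:R) (fun ij => f (peval h (bpoly ij))) (f h).
rewrite -fS m0 rmorph1 f1 => /(_ _ erefl).
have -> : \sum_(i <- bernstein n.+1)
    (n.+1%:R^-1 * i.1%:R)%:C%C *: f (peval h (bpoly i)) = f h.
  under eq_bigr do rewrite rmorphM -scalerA -fZ.
  rewrite -scaler_sumr -fS; under eq_bigr do rewrite -mul_polyC polyC_natr.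
  by rewrite m1 -polyC_natr mul_polyC fZ fX scalerA -rmorphM mulVf// scale1r.
have -> : \sum_(i <- bernstein n.+1)
    ((n.+1%:R^-1 * i.1%:R) ^+ 2)%:C%C *: f (peval h (bpoly i)) =
    f (h ^+ 2) + n.+1%:R^-1%:C%C *: f (peval h ('X * (1 - 'X))).
  under eq_bigr do rewrite exprMn rmorphM -scalerA -fZ.
  rewrite -scaler_sumr -fS.
  under eq_bigr do rewrite -mul_polyC polyC_exp polyC_natr.
  rewrite m2 -polyC_natr -polyC_exp !mul_polyC fD !fZ scalerDr !scalerA.
  rewrite -!rmorphM /= -exprMn mulVf// expr1n scale1r.
  rewrite rmorphXn /= pevalX1; congr (_ + _%:C%C *: _).
  by rewrite expr2 -mulrA mulVf// mulr1.
rewrite addrAC; apply=> // ij; apply: f_pos => //.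
exact: positive_peval_bernstein.
Qed.

(** Kadison's inequality. On the commutative algebra generated by [h] a positive
    map behaves as a completely positive one: Bernstein polynomials spread [h]
    over a positive partition of unity with variance of order [1 / n], and the
    image of this partition has a positive operator variance. *)
Lemma kadison h : S h -> selfadjoint h -> positive_op (f (h ^+ 2) - f h ^+ 2).
Proof.
move=> Sh hsa.
have [m m0 hm] : exists2 m, 0 < m & opnorm h <= m.
  by exists (opnorm h + 1); rewrite ?lerDl// ltr_wpDl ?opnorm_ge0.
have [k k0 kE] : exists2 k, 0 < k & k * (m *+ 2) = 1.
  exists (m *+ 2)^-1; first by rewrite invr_gt0 mulrn_wgt0.
  by rewrite mulVf// mulrn_eq0 /= gt_eqF.
have Shn := S_pow Sh hsa.
have Sp p : S (peval h p) by exact: subspace_peval.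
have fD := pu_pevalD S_lin f_pu Shn; have fZ := pu_pevalZ S_lin f_pu Shn.
(* this affine polynomial maps the interval [- m, m] onto [0, 1] *)
have [q qdef] : exists q : {poly R}, q = k *: (m%:P + 'X) by eexists.
have qE : q ^+ 2 = k ^+ 2 *: ('X ^+ 2 + (m *+ 2) *: 'X + (m ^+ 2)%:P).
  rewrite qdef -!mul_polyC !polyC_exp polyCMn; ring.
have fq : f (peval h q) = peval (f h) q.
  rewrite qdef fZ fD !pevalZ [peval (f h) _]rmorphD /= !pevalC !pevalX1.
  by rewrite (pu_scalar S_lin S1 f_pu).
have := @kadison01 (peval h q) (Sp _).
rewrite fq -!rmorphXn /= qE fZ pevalZ -scalerBr !fD !rmorphD /=.
rewrite fZ pevalZ !pevalC !pevalX1 (pu_scalar S_lin S1 f_pu).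
rewrite opprD addrACA subrr addr0 opprD addrACA subrr addr0.
rewrite !rmorphXn /= !pevalX1 => P.
have -> : f (h ^+ 2) - f h ^+ 2 =
    (k ^- 2)%:C%C *: ((k ^+ 2)%:C%C *: (f (h ^+ 2) - f h ^+ 2)).
  by rewrite scalerA -rmorphM mulVf ?scale1r// sqrf_eq0 gt_eqF.
apply: positiveZ; first by rewrite invr_ge0 sqr_ge0.
rewrite rmorphXn; apply: P; rewrite qdef.
  rewrite pevalZ rmorphD /= pevalC pevalX1.
  by apply: positiveZ; [exact: ltW|exact: positive_opnormD].
have -> : 1 - peval h (k *: (m%:P + 'X)) = k%:C%C *: (m%:S - h).
  rewrite pevalZ rmorphD /= pevalC pevalX1.
  have {1}-> : 1 = k%:C%C *: (m *+ 2)%:S :> bop H.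
    by rewrite scalerA -rmorphM kE scale1r.
  rewrite -scalerBr mulr2n rmorphD scalerDl opprD addrACA subrr add0r.
  by [].
by apply: positiveZ; [exact: ltW|exact: positive_opnorm].
Qed.

End Kadison.

(** * The Jordan product *)

Section Jordan.
Context {R : realType} {H : hilbertType R}.
Implicit Types (a : R[i]) (x y z h : bop H).

Lemma jordanC x y : jordan x y = jordan y x.
Proof. by rewrite /jordan addrC. Qed.

Lemma jordanDl x y z : jordan (x + y) z = jordan x z + jordan y z.
Proof. by rewrite /jordan mulrDl mulrDr addrACA scalerDr. Qed.

Lemma jordanZl a x y : jordan (a *: x) y = a *: jordan x y.
Proof. by rewrite /jordan bopZl bopZr -scalerDr !scalerA mulrC. Qed.

Lemma jordanDr x y z : jordan z (x + y) = jordan z x + jordan z y.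
Proof. by rewrite !(jordanC z) jordanDl. Qed.

Lemma jordanZr a x y : jordan x (a *: y) = a *: jordan x y.
Proof. by rewrite !(jordanC x) jordanZl. Qed.

Lemma adjoint_jordan x y : adjoint (jordan x y) = jordan (adjoint x) (adjoint y).
Proof.
rewrite /jordan adjointZ adjointD !adjointM addrC.
suff -> : conjC (2%:R^-1 : R[i]) = 2%:R^-1 by [].
by rewrite fmorphV rmorph_nat.
Qed.

Lemma jordan_exp x n : jordan x (x ^+ n) = x ^+ n.+1.
Proof. by rewrite /jordan -exprS -exprSr inv2E double_scaler2. Qed.

Lemma sqrD_jordan x y : (x + y) ^+ 2 = x ^+ 2 + y ^+ 2 + 2%:R *: jordan x y.
Proof.
rewrite /jordan scalerA mulfV ?pnatr_eq0// scale1r !expr2 mulrDl !mulrDr.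
by rewrite [y * x + _]addrC addrACA.
Qed.

Lemma jordan_adjoint_self x y : selfadjoint x -> selfadjoint y ->
  jordan (adjoint (x + 'i%C *: y)) (x + 'i%C *: y) = x ^+ 2 + y ^+ 2.
Proof.
move=> xsa ysa; rewrite adjoint_decomp// -scaleNr.
rewrite jordanDl !jordanDr !jordanZl !jordanZr !jordan_sq (jordanC y).
rewrite scaleNr addrA addrK scaleNr scalerA -[_ * 'i%C]/('i%C ^+ 2) sqr_i.
by rewrite scaleN1r opprK.
Qed.

End Jordan.

(** * The definite set and the multiplicative core *)

Lemma UP_pu {R : realType} {H K : hilbertType R} (N : set (bop K))
    (M : set (bop H)) (E : bop K -> bop H) :
  UP_map N M E -> positive_unital N E.
Proof. by case=> _ l e p _. Qed.

Section DefiniteSet.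
Context {R : realType} {H : hilbertType R}.
Variables (M : set (bop H)) (phi : bop H -> bop H).
Hypothesis M_vna : von_neumann_algebra M.
Hypothesis phi_UP : UP_map M M phi.
Implicit Types (a : R[i]) (x y z h : bop H).

Lemma vna_lin : linear_subspace M. Proof. by case: M_vna => -[]. Qed.
Lemma vna1 : M 1. Proof. by case: M_vna => -[]. Qed.
Lemma vna_adj x : M x -> M (adjoint x).
Proof. by case: M_vna => -[_ _ + _] _; apply. Qed.
Lemma vnaM x y : M x -> M y -> M (x * y).
Proof. by case: M_vna => _; apply. Qed.

Lemma vnaX x n : M x -> M (x ^+ n).
Proof.
move=> Mx; elim: n => [|n IH]; first exact: vna1.
by rewrite exprS; exact: vnaM.
Qed.

Lemma vna_jordan x y : M x -> M y -> M (jordan x y).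
Proof.
move=> Mx My; apply: (subspaceZ vna_lin).
by apply: (subspaceD vna_lin); exact: vnaM.
Qed.

Lemma vna_re x : M x -> M (re_op x).
Proof. by move=> Mx; apply: (subspace_re vna_lin) => //; exact: vna_adj. Qed.

Lemma vna_im x : M x -> M (im_op x).
Proof. by move=> Mx; apply: (subspace_im vna_lin) => //; exact: vna_adj. Qed.

Let phi_pu := UP_pu phi_UP.
Let phi_lin : linear_on M phi. Proof. by case: phi_UP. Qed.

Lemma phiM x : M x -> M (phi x).
Proof. by case: phi_UP => + _ _ _ _; apply. Qed.

Let phi_sa x : M x -> selfadjoint x -> selfadjoint (phi x).
Proof. exact: (pu_selfadjoint vna_lin vna1 phi_pu). Qed.

Lemma phi_kadison h : M h -> selfadjoint h ->
  positive_op (phi (h ^+ 2) - phi h ^+ 2).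
Proof.
by apply: (kadison vna_lin vna1 phi_pu) => // x Mx _ n; exact: vnaX.
Qed.

(** Kadison's inequality for [t x + y] is affine in [t] when it is an equality
    for [x]; its slope therefore vanishes. *)
Lemma kadison_eq_jordan_sa x y : M x -> selfadjoint x -> M y ->
  selfadjoint y -> phi (x ^+ 2) = phi x ^+ 2 ->
  phi (jordan x y) = jordan (phi x) (phi y).
Proof.
move=> Mx xsa My ysa xd.
have Mxy := vna_jordan Mx My.
pose D := phi (jordan x y) - jordan (phi x) (phi y).
have Dsa : selfadjoint D.
  apply: selfadjointB; first by apply: phi_sa => //; exact: selfadjoint_jordan.
  by apply: selfadjoint_jordan; exact: phi_sa.
pose E := phi (y ^+ 2) - phi y ^+ 2.
have key (t : R) : positive_op ((t *+ 2)%:C%C *: D + E).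
  have Mtx : M (t%:C%C *: x) by exact: (subspaceZ vna_lin).
  have Mx2 := vnaX 2 Mx; have My2 := vnaX 2 My.
  have Mt2 : M ((t%:C%C ^+ 2) *: x ^+ 2) by exact: (subspaceZ vna_lin).
  have MtJ : M (t%:C%C *: jordan x y) by exact: (subspaceZ vna_lin).
  have M2tJ : M (2%:R *: (t%:C%C *: jordan x y)) by exact: (subspaceZ vna_lin).
  have := @phi_kadison (t%:C%C *: x + y) (subspaceD vna_lin Mtx My).
  move=> /(_ (selfadjointD (selfadjointZ t xsa) ysa)).
  rewrite (linear_onD phi_lin)// (linear_onZ vna_lin phi_lin)//.
  have sqZ (K : hilbertType R) (z : bop K) : (t%:C%C *: z) ^+ 2 = t%:C%C ^+ 2 *: z ^+ 2.
    by rewrite !expr2 bopZl bopZr scalerA.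
  rewrite !sqrD_jordan !sqZ !jordanZl.
  have MS : M (t%:C%C ^+ 2 *: x ^+ 2 + y ^+ 2) by exact: (subspaceD vna_lin).
  rewrite !(linear_onD phi_lin)// (linear_onZ vna_lin phi_lin (t%:C%C ^+ 2))//.
  rewrite (linear_onZ vna_lin phi_lin 2%:R)//.
  rewrite (linear_onZ vna_lin phi_lin t%:C%C)//.
  rewrite xd opprD addrACA [- (_ + phi y ^+ 2)]opprD.
  rewrite [X in positive_op (X + _)]addrACA subrr add0r.
  rewrite -!scalerBr scalerA -/D -/E.
  by rewrite mulr_natl -rmorphMn addrC.
have pos (s : R) (n : nat) : s ^+ 2 = 1 ->
    positive_op (s%:C%C *: D + n.+1%:R^-1%:C%C *: E).
  move=> s1; have -> : s%:C%C *: D + n.+1%:R^-1%:C%C *: E =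
      n.+1%:R^-1%:C%C *: (((s * n.+1%:R / 2) *+ 2)%:C%C *: D + E).
    rewrite [RHS]scalerDr [in RHS]scalerA -rmorphM; congr (_%:C%C *: _ + _).
    have : n.+1%:R != 0 :> R by rewrite pnatr_eq0.
    by move: n.+1%:R => k k0; rewrite -mulr_natl; field.
  by apply: positiveZ; rewrite ?invr_ge0.
apply/eqP; rewrite -subr_eq0 -/D; apply/eqP; apply: positive_le0_eq0.
  apply: (positive_archimedean (y := E) Dsa) => n.
  by have := pos 1 n (expr1n _ _); rewrite rmorph1 scale1r.
apply: (positive_archimedean (y := E)); first exact: selfadjointN.
by move=> n; have := pos (-1) n (sqrr_sign _ 1); rewrite rmorphN1 scaleN1r.
Qed.

Lemma phi_decomp x : M x -> phi x = phi (re_op x) + 'i%C *: phi (im_op x).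
Proof.
by move=> Mx; apply: (pu_re_im vna_lin phi_pu) => //; exact: vna_adj.
Qed.

Lemma phi_adjoint x : M x -> phi (adjoint x) = adjoint (phi x).
Proof.
by move=> Mx; apply: (pu_adjoint vna_lin vna1 phi_pu) => //; exact: vna_adj.
Qed.

(** The defect of [x] is the sum of the Kadison defects of its real and imaginary
    parts, so both vanish and both parts are multiplicative. Unlike the definition,
    the resulting condition is visibly linear in [x]. *)
Lemma definite_setP x : definite_set M phi x <->
  M x /\ forall y, M y -> phi (jordan x y) = jordan (phi x) (phi y).
Proof.
split=> [[Mx xd]|[Mx xd]]; last first.
  split=> //; rewrite jordanC xd ?phi_adjoint//; last exact: vna_adj.
  exact: jordanC.
split=> // y My.
have Mr := vna_re Mx; have Mi := vna_im Mx.
have rsa := selfadjoint_re x; have isa := selfadjoint_im x.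
(* the two Kadison defects are positive with sum 0 *)
have dsum : (phi (re_op x ^+ 2) - phi (re_op x) ^+ 2) +
    (phi (im_op x ^+ 2) - phi (im_op x) ^+ 2) = 0.
  move: xd; rewrite (phi_decomp Mx) {1 2}[x]re_imE.
  rewrite !jordan_adjoint_self; try by [|exact: phi_sa].
  rewrite (linear_onD phi_lin); [move=> xd|exact: vnaX|exact: vnaX].
  by rewrite addrACA -opprD xd subrr.
have kr := phi_kadison Mr rsa; have ki := phi_kadison Mi isa.
have dr : phi (re_op x ^+ 2) - phi (re_op x) ^+ 2 = 0.
  apply: positive_le0_eq0 => //.
  by move/eqP: dsum; rewrite addr_eq0 => /eqP ->; rewrite opprK.
have di : phi (im_op x ^+ 2) - phi (im_op x) ^+ 2 = 0.
  by move: dsum; rewrite dr add0r.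
move/eqP: dr; rewrite subr_eq0 => /eqP dr.
move/eqP: di; rewrite subr_eq0 => /eqP di.
have half z : M z -> selfadjoint z -> phi (z ^+ 2) = phi z ^+ 2 ->
    phi (jordan z y) = jordan (phi z) (phi y).
  move=> Mz zsa zd; have Myr := vna_re My; have Myi := vna_im My.
  have ysar := selfadjoint_re y; have ysai := selfadjoint_im y.
  rewrite [in LHS](re_imE y) jordanDr (jordanZr 'i%C) (phi_decomp My).
  rewrite jordanDr (jordanZr 'i%C).
  rewrite (linear_onD phi_lin); last 2 first.
  - exact: vna_jordan.
  - by apply: (subspaceZ vna_lin); exact: vna_jordan.
  rewrite (linear_onZ vna_lin phi_lin 'i%C); last exact: vna_jordan.
  by rewrite !kadison_eq_jordan_sa.
rewrite [in LHS](re_imE x) jordanDl (jordanZl 'i%C) (phi_decomp Mx).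
rewrite jordanDl (jordanZl 'i%C).
rewrite (linear_onD phi_lin); last 2 first.
- exact: vna_jordan.
- by apply: (subspaceZ vna_lin); exact: vna_jordan.
rewrite (linear_onZ vna_lin phi_lin 'i%C); last exact: vna_jordan.
by rewrite !half.
Qed.

Lemma definite_set_lin : linear_subspace (definite_set M phi).
Proof.
split.
  apply/definite_setP; split; first exact: (subspace0 vna_lin).
  move=> y My; rewrite (linear_on0 vna_lin phi_lin) -(scale0r 0) !jordanZl.
  by rewrite !scale0r (linear_on0 vna_lin phi_lin).
move=> a x y /definite_setP[Mx xd] /definite_setP[My yd].
apply/definite_setP; split.
  by apply: (subspaceD vna_lin) => //; exact: (subspaceZ vna_lin).
move=> z Mz; rewrite jordanDl jordanZl [LHS]phi_lin//; try exact: vna_jordan.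
by rewrite xd// yd// phi_lin// jordanDl jordanZl.
Qed.

Lemma definite_set_adjoint x :
  definite_set M phi x -> definite_set M phi (adjoint x).
Proof.
move=> /definite_setP[Mx xd]; apply/definite_setP; split; first exact: vna_adj.
move=> y My; rewrite -[y in LHS]adjointK -adjoint_jordan phi_adjoint.
  rewrite xd; last exact: vna_adj.
  by rewrite adjoint_jordan (phi_adjoint My) adjointK phi_adjoint.
by apply: vna_jordan => //; exact: vna_adj.
Qed.

Lemma definite_set_phi_jordan x y : definite_set M phi x -> M y ->
  phi (jordan x y) = jordan (phi x) (phi y).
Proof. by move=> /definite_setP[_]; apply. Qed.

Lemma definite_set_phiX x n : definite_set M phi x ->
  phi (x ^+ n) = phi x ^+ n.
Proof.
move=> xd; have Mx : M x by case: xd.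
elim: n => [|n IH]; first by rewrite !expr0; case: phi_pu.
by rewrite -!jordan_exp definite_set_phi_jordan// ?IH//; exact: vnaX.
Qed.

(** Multiplicativity on [x] gives [phi (x ^ 4) = phi x ^ 4], which is the equality
    case for [x ^ 2]. *)
Lemma definite_set_sq x : definite_set M phi x -> selfadjoint x ->
  definite_set M phi (x ^+ 2).
Proof.
move=> xd xsa; have Mx : M x by case: xd.
split; first exact: vnaX.
have x2sa := selfadjointX 2 xsa.
rewrite -(phi_adjoint (vnaX 2 Mx)) x2sa !jordan_sq.
by rewrite -exprM !definite_set_phiX// -exprM.
Qed.

Lemma jordan_polarize x y :
  jordan x y = (2^-1)%:C%C *: ((x + y) ^+ 2 - x ^+ 2 - y ^+ 2).
Proof.
by rewrite sqrD_jordan [x ^+ 2 + _ + _]addrC -addrA -opprD addrK scalerA -inv2E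
  mulVf ?scale1r.
Qed.

Lemma definite_set_jordan x y : definite_set M phi x -> definite_set M phi y ->
  definite_set M phi (jordan x y).
Proof.
have lin := definite_set_lin.
have sa_case u v : definite_set M phi u -> definite_set M phi v ->
    selfadjoint u -> selfadjoint v -> definite_set M phi (jordan u v).
  move=> du dv usa vsa; rewrite jordan_polarize; apply: (subspaceZ lin).
  apply: (subspaceB lin); last exact: definite_set_sq.
  apply: (subspaceB lin); last exact: definite_set_sq.
  by apply: definite_set_sq; [exact: (subspaceD lin)|exact: selfadjointD].
move=> dx dy; rewrite (re_imE x) (re_imE y).
have dx' := definite_set_adjoint dx; have dy' := definite_set_adjoint dy.
have drx := subspace_re lin dx dx'; have dix := subspace_im lin dx dx'.
have dry := subspace_re lin dy dy'; have diy := subspace_im lin dy dy'.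
have [rx ix] := (selfadjoint_re x, selfadjoint_im x).
have [ry iy] := (selfadjoint_re y, selfadjoint_im y).
rewrite jordanDl !jordanDr !(jordanZl 'i%C) !(jordanZr 'i%C).
by do ![exact: sa_case|apply: (subspaceD lin)|apply: (subspaceZ lin)].
Qed.

Lemma iter_phiM n x : M x -> M (iter n phi x).
Proof. by move=> Mx; elim: n => // n IH /=; exact: phiM. Qed.

Lemma iter_phi_lin n : linear_on M (iter n phi).
Proof.
move=> a x y Mx My; elim: n => // n IH /=.
by rewrite IH phi_lin//; exact: iter_phiM.
Qed.

Lemma iter_phi_adjoint n x : M x -> iter n phi (adjoint x) = adjoint (iter n phi x).
Proof.
by move=> Mx; elim: n => // n IH /=; rewrite IH phi_adjoint//; exact: iter_phiM.
Qed.

Lemma iter_phi_pu n : positive_unital M (iter n phi).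
Proof.
split; first exact: iter_phi_lin.
- by elim: n => // n IH /=; rewrite IH; case: phi_pu.
- move=> x Mx x0; elim: n => // n IH /=.
  by case: phi_pu => _ _; apply => //; exact: iter_phiM.
Qed.

Lemma orbit_lin : linear_subspace (orbit_definite_set M phi).
Proof.
split.
  split; first exact: (subspace0 vna_lin).
  move=> n; rewrite (linear_on0 vna_lin (iter_phi_lin n)).
  exact: (subspace0 definite_set_lin).
move=> a x y [Mx xd] [My yd]; split.
  by apply: (subspaceD vna_lin) => //; exact: (subspaceZ vna_lin).
move=> n; rewrite iter_phi_lin//; case: definite_set_lin => _; exact.
Qed.

Lemma orbit_adjoint x : orbit_definite_set M phi x ->
  orbit_definite_set M phi (adjoint x).
Proof.
move=> [Mx xd]; split; first exact: vna_adj.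
by move=> n; rewrite iter_phi_adjoint//; exact: definite_set_adjoint.
Qed.

Lemma orbit_iter_jordan x y n : orbit_definite_set M phi x ->
  orbit_definite_set M phi y ->
  iter n phi (jordan x y) = jordan (iter n phi x) (iter n phi y).
Proof.
move=> [Mx xd] [My yd]; elim: n => // n IH /=.
by rewrite IH definite_set_phi_jordan//; exact: iter_phiM.
Qed.

Lemma orbit_jordan x y : orbit_definite_set M phi x ->
  orbit_definite_set M phi y -> orbit_definite_set M phi (jordan x y).
Proof.
move=> xd yd; have [Mx dx] := xd; have [My dy] := yd.
split; first exact: vna_jordan.
by move=> n; rewrite orbit_iter_jordan//; exact: definite_set_jordan.
Qed.

Lemma orbit_iterX x n k : orbit_definite_set M phi x ->
  iter n phi (x ^+ k) = iter n phi x ^+ k.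
Proof.
by move=> [Mx dx]; elim: n => // n IH /=; rewrite IH definite_set_phiX.
Qed.

Lemma orbit_iter_peval x n p : orbit_definite_set M phi x ->
  iter n phi (peval x p) = peval (iter n phi x) p.
Proof.
move=> xd; have Mx : M x by case: xd.
have Mxk k : M (x ^+ k) by exact: vnaX.
have L := iter_phi_lin n.
rewrite /peval.
have : forall s : seq 'I_(size p), iter n phi (\sum_(i <- s) (p`_i)%:C%C *: x ^+ i) =
    \sum_(i <- s) (p`_i)%:C%C *: iter n phi x ^+ i.
  have MS (s : seq 'I_(size p)) : M (\sum_(i <- s) (p`_i)%:C%C *: x ^+ i).
    elim/big_ind: _; first exact: (subspace0 vna_lin).
      exact: (subspaceD vna_lin).
    by move=> i _; exact: (subspaceZ vna_lin).
  elim=> [|i s IH]; first by rewrite !big_nil (linear_on0 vna_lin L).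
  by rewrite !big_cons L// IH orbit_iterX.
by apply.
Qed.

Lemma multiplicative_core_jordan : jordan_subalgebra M (multiplicative_core M phi).
Proof.
split.
- by move=> x /(_ 1%N isT)[y [My _] <-]; exact: phiM.
- split.
    move=> n _; exists 0; first exact: (subspace0 orbit_lin).
    exact: (linear_on0 vna_lin (iter_phi_lin n)).
  move=> a x y xC yC n n0; have [x' x'B <-] := xC n n0.
  have [y' y'B <-] := yC n n0; exists (a *: x' + y').
    by case: orbit_lin => _; apply.
  by rewrite iter_phi_lin//; [case: x'B|case: y'B].
- move=> x y xC yC n n0; have [x' x'B <-] := xC n n0.
  have [y' y'B <-] := yC n n0; exists (jordan x' y').
    exact: orbit_jordan.
  exact: orbit_iter_jordan.
Qed.

End DefiniteSet.

(** * The weak* topology *)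

Section InitialTopologies.

Lemma cvg_initial {S : choiceType} {T : topologicalType} (f : S -> T)
    (F : set_system S) (x : S) : Filter F ->
  f @ F --> f x -> F --> (x : initial_topology f).
Proof.
move=> FF fx A /=; rewrite /= nbhsE => -[B [[C oC <-] Cx] BA].
by apply: filterS BA _; apply: fx; rewrite /= nbhsE; exists C.
Qed.

Lemma cvg_ptws {U : Type} {V : topologicalType} (F : set_system (U -> V))
    (f : U -> V) : Filter F ->
  (forall t, (fun g => g t) @ F --> f t) -> {ptws, F --> f}.
Proof. by move=> FF h; apply/cvg_sup => t; apply: cvg_initial. Qed.

Lemma ptws_eval_continuous {U : Type} {V : topologicalType} (t : U) :
  continuous (fun g : {ptws U -> V} => g t).
Proof.
move=> g; have /cvg_sup/(_ t) h : g --> (g : {ptws U -> V}) by exact: cvg_id.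
move=> A Ag; apply: h; have := @initial_continuous _ _ (fun f : {ptws U -> V} => f t).
by move=> /(_ g A); exact.
Qed.

End InitialTopologies.

Section ComplexLimits.
Context {R : realType}.

Lemma rnorm_complex_le (z : R[i]) :
  `|z| <= (`|complex.Re z| + `|complex.Im z|)%:C%C.
Proof.
rewrite normc_def lecR; case: z => a b /=.
rewrite -[leRHS]ger0_norm ?addr_ge0// -sqrtr_sqr ler_wsqrtr//.
by rewrite sqrrD !real_normK ?num_real// lerD2r lerDl mulrn_wge0// mulr_ge0.
Qed.

Lemma cvg_complex {T : Type} (F : set_system T) (f g : T -> R) (a b : R) :
  Filter F -> f @ F --> a -> g @ F --> b ->
  (fun t => (f t +i* g t)%C : R[i]^o) @ F --> ((a +i* b)%C : R[i]^o).
Proof.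
move=> FF /cvgrPdist_lt fa /cvgrPdist_lt gb; apply/cvgrPdist_lt => e e0.
have eE : e = (complex.Re e)%:C%C.
  by case: e e0 => c d; rewrite ltcE /= => /andP[/eqP-> _].
have re0 : 0 < complex.Re e / 2.
  by rewrite divr_gt0//; move: e0; rewrite ltcE => /andP[].
apply: filterS2 (fa _ re0) (gb _ re0) => t h1 h2.
rewrite eE; apply: le_lt_trans (rnorm_complex_le _) _; rewrite ltcR /=.
by rewrite [ltRHS]splitr ltrD.
Qed.

Lemma cvg_Re {T : Type} (F : set_system T) (f : T -> R[i]^o) (z : R[i]^o) :
  Filter F -> f @ F --> z -> (fun t => complex.Re (f t)) @ F --> complex.Re z.
Proof.
move=> FF /cvgrPdist_lt fz; apply/cvgrPdist_lt => e e0.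
have := fz e%:C%C; rewrite ltcR => /(_ e0); apply: filterS => t.
rewrite -ltcR; apply: le_lt_trans; rewrite -ReN -ReD.
exact: normc_ge_Re.
Qed.

End ComplexLimits.

Section NormalFunctionals.
Context {R : realType} {H : hilbertType R}.
Implicit Types (x y : bop H) (p : l2seq H * l2seq H) (n : nat) (r : R).

Definition wterm p x n : R := rinner (x (sval p.1 n)) (sval p.2 n).

(** Real parts suffice: the imaginary part of a normal functional is the real
    part of another one, by [normal_functionalE]. *)
Definition wfun p x : R := limn (series (wterm p x)).

Definition wbound p n : R := rnorm (sval p.1 n) ^+ 2 + rnorm (sval p.2 n) ^+ 2.

Lemma wbound_ge0 p n : 0 <= wbound p n.
Proof. by rewrite addr_ge0 ?sqr_ge0. Qed.

Lemma wbound_cvg p : cvgn (series (wbound p)).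
Proof.
have := is_cvg_seriesD (svalP p.1) (svalP p.2).
by congr (cvgn (series _)).
Qed.

Lemma wterm_le p x n : `|wterm p x n| <= opnorm x * wbound p n.
Proof.
apply: le_trans (rinner_bop_le _ _ _) _; rewrite -mulrA ler_wpM2l ?opnorm_ge0//.
rewrite /wbound.
have := sqr_ge0 (rnorm (sval p.1 n) - rnorm (sval p.2 n)).
have := sqr_ge0 (rnorm (sval p.1 n)); have := sqr_ge0 (rnorm (sval p.2 n)).
by lra.
Qed.

Lemma wterm_norm_cvg p x : cvgn (series (fun n => `|wterm p x n|)).
Proof.
apply: (@series_le_cvg _ _ (fun n => opnorm x * wbound p n)).
- by move=> n.
- by move=> n; rewrite mulr_ge0 ?opnorm_ge0 ?wbound_ge0.
- exact: wterm_le.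
- have := (@is_cvg_seriesZ R (wbound p) (opnorm x) (@wbound_cvg p)). exact.
Qed.

Lemma wterm_cvg p x : cvgn (series (wterm p x)).
Proof. by have := @normed_cvg R R^o (wterm p x); apply; exact: wterm_norm_cvg. Qed.

Lemma wfunD p x y : wfun p (x + y) = wfun p x + wfun p y.
Proof.
rewrite /wfun -lim_seriesD; [|exact: wterm_cvg|exact: wterm_cvg].
congr (limn (series _)); apply/funext => n.
by rewrite fctE /wterm bopE rinnerDl.
Qed.

Lemma wfunZ p r x : wfun p (r%:C%C *: x) = r * wfun p x.
Proof.
rewrite /wfun -[RHS](@lim_seriesZ R (wterm p x)); last exact: wterm_cvg.
congr (limn (series _)); apply/funext => n.
by rewrite fctE /wterm bopE rinnerZl.
Qed.

Lemma wfunN p x : wfun p (- x) = - wfun p x.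
Proof. by rewrite -scaleN1r -[-1]/(- 1%:C%C) -rmorphN wfunZ mulN1r. Qed.

Lemma wfunB p x y : wfun p (x - y) = wfun p x - wfun p y.
Proof. by rewrite wfunD wfunN. Qed.

Lemma wfun_le p x : `|wfun p x| <= opnorm x * limn (series (wbound p)).
Proof.
apply: le_trans (@lim_series_norm _ R^o _ (@wterm_norm_cvg p x)) _.
rewrite -[leRHS](@lim_seriesZ R (wbound p)); last exact: wbound_cvg.
apply: lim_series_le; [exact: wterm_norm_cvg| |exact: wterm_le].
exact: (@is_cvg_seriesZ R (wbound p) (opnorm x) (@wbound_cvg p)).
Qed.

Lemma l2seq_scale_subproof (a : R[i]) (xi : l2seq H) :
  cvgn (series (fun n => rnorm (a *: sval xi n) ^+ 2)).
Proof.
have -> : (fun n => rnorm (a *: sval xi n) ^+ 2) =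
    (complex.Re `|a| ^+ 2) *: (fun n => rnorm (sval xi n) ^+ 2 : R^o).
  by apply/funext => n; rewrite rnormZ exprMn.
exact: (@is_cvg_seriesZ R _ _ (svalP xi)).
Qed.

Definition l2scale (a : R[i]) (xi : l2seq H) : l2seq H :=
  exist (fun z : nat -> H => cvgn (series (fun n => rnorm (z n) ^+ 2)))
    (fun n => a *: sval xi n) (@l2seq_scale_subproof a xi).

(** Rotating the second sequence by the imaginary unit turns the imaginary part of
    a normal functional into a real part. *)
Definition irot p : l2seq H * l2seq H := (p.1, l2scale 'i%C p.2).

Lemma normal_functional_cvg p x :
  series (fun n => inner H (x (sval p.1 n)) (sval p.2 n) : R[i]^o) @ \oo -->
  ((wfun p x +i* wfun (irot p) x)%C : R[i]^o).
Proof.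
have -> : series (fun n => inner H (x (sval p.1 n)) (sval p.2 n) : R[i]^o) =
    fun n => (series (wterm p x) n +i* series (wterm (irot p) x) n)%C : R[i]^o.
  apply/funext => n; rewrite /series /=.
  elim/big_ind3 : _ => //.
    by move=> a b c d e f -> ->.
  by move=> i _; rewrite innerE.
by apply: cvg_complex; exact: wterm_cvg.
Qed.

Lemma normal_functionalE p x :
  normal_functionals x p = (wfun p x +i* wfun (irot p) x)%C.
Proof. by apply: cvg_lim => //; exact: normal_functional_cvg. Qed.

Lemma normal_functional_continuous p :
  continuous (fun x : weak_star H => normal_functionals x p).
Proof.
move=> x; apply: (@continuous_comp (weak_star H) {ptws _ -> _} (R[i]^o)
  (fun y => normal_functionals y) (fun g => g p)).
  exact: initial_continuous.
exact: ptws_eval_continuous.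
Qed.

Lemma wfun_continuous p : continuous (wfun p : weak_star H -> R).
Proof.
have -> : wfun p = fun x => complex.Re (normal_functionals x p).
  by apply/funext => x; rewrite normal_functionalE.
move=> x; apply: (@cvg_Re R _ (nbhs x) (fun x => normal_functionals x p)).
exact: normal_functional_continuous.
Qed.

Lemma cvg_weak_star (F : set_system (bop H)) x : Filter F ->
  (forall p, wfun p @ F --> wfun p x) -> F --> (x : weak_star H).
Proof.
move=> FF Fx; apply: cvg_initial; apply: cvg_ptws => p.
have -> : (fun g : {ptws _ -> _} => g p) @ (normal_functionals (H := H) @ F) =
    (fun y => (wfun p y +i* wfun (irot p) y)%C : R[i]^o) @ F.
  rewrite -fmap_comp; congr (_ @ F); apply/funext => y /=.
  exact: normal_functionalE.
by rewrite normal_functionalE; apply: cvg_complex; exact: Fx.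
Qed.

End NormalFunctionals.

(** * Weak* compactness and separation *)

Section WeakStarCompactness.
Context {R : realType} {H : hilbertType R}.
Implicit Types (x y k : bop H) (p : l2seq H * l2seq H) (r : R) (u v w : H).

Lemma ultra_cvg_compact {T : Type} {V : topologicalType} (F : set_system T)
    (f : T -> V) (K : set V) : UltraFilter F -> compact K ->
  F (f @^-1` K) -> exists2 l, K l & f @ F --> l.
Proof.
move=> FU Kco FK; have [l [Kl lcl]] := Kco (f @ F) _ FK.
exists l => // A Al; rewrite /= /fmap /=.
have [//|FnA] := in_ultra_setVsetC (f @^-1` A) FU.
by have [z [/= nAz Az]] := lcl (~` A) A FnA Al.
Qed.

Lemma wfun_tail p x n :
  `|wfun p x - series (wterm p x) n| <=
  opnorm x * (limn (series (wbound p)) - series (wbound p) n).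
Proof.
have xc : (fun m => `|series (wterm p x) m - series (wterm p x) n|) @ \oo -->
    `|wfun p x - series (wterm p x) n|.
  by apply: cvg_norm; apply: cvgB; [exact: wterm_cvg|exact: cvg_cst].
rewrite -(cvg_lim _ xc)//; apply: limr_le; first by apply/cvg_ex; eexists; exact: xc.
exists n => // m /= nm; rewrite sub_series_geq//.
apply: le_trans (ler_norm_sum _ _ _) _.
apply: (@le_trans _ _ (\sum_(n <= k < m) opnorm x * wbound p k)).
  by apply: ler_sum => k _; exact: wterm_le.
rewrite -mulr_sumr ler_wpM2l ?opnorm_ge0// -sub_series_geq// lerD2r.
apply: nondecreasing_cvgn_le; last exact: wbound_cvg.
by apply: nondecreasing_series => k _ _; exact: wbound_ge0.
Qed.

(** On a ball the normal functionals are uniform limits of finite sums of matrix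
    coefficients, so that there the weak operator topology controls the weak*
    topology. *)
Lemma cvg_weak_star_ball (F : set_system (bop H)) x r : Filter F ->
  F [set y | opnorm y <= r] -> opnorm x <= r ->
  (forall u v, (fun y : bop H => rinner (y u) v) @ F --> rinner (x u) v) ->
  F --> (x : weak_star H).
Proof.
move=> FF Fr xr Fx; apply: cvg_weak_star => p; apply/cvgrPdist_lt => e e0.
have r0 : 0 <= r by apply: le_trans xr; exact: opnorm_ge0.
have d0 : 0 < e / (4 * (r + 1)) by rewrite divr_gt0// mulr_gt0// ltr_wpDl.
have [n nP] : exists n,
    limn (series (wbound p)) - series (wbound p) n < e / (4 * (r + 1)).
  have /cvgrPdist_lt/(_ _ d0)[n _ /(_ n (leqnn n)) /=] := @wbound_cvg _ _ p.
  by exists n; exact: le_lt_trans (ler_norm _) _.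
have sF : (fun y => series (wterm p y) n) @ F --> series (wterm p x) n.
  rewrite /series /=; elim: n {nP} => [|n IH].
    under eq_fun do rewrite big_geq//.
    by rewrite big_geq//; exact: cvg_cst.
  under eq_fun do rewrite big_nat_recr//=.
  by rewrite big_nat_recr//=; apply: cvgD => //; exact: Fx.
have e2 : 0 < e / 2 by rewrite divr_gt0.
move/cvgrPdist_lt : sF => /(_ _ e2).
apply: filterS2 Fr => y yr yn.
have tail z : opnorm z <= r -> `|wfun p z - series (wterm p z) n| <= e / 4.
  move=> zr; apply: le_trans (wfun_tail p z n) _.
  apply: (@le_trans _ _ ((r + 1) * (e / (4 * (r + 1))))); last first.
    by rewrite le_eqVlt; apply/orP; left; apply/eqP; field; rewrite gt_eqF// ltr_wpDl.
  apply: ler_pM; [exact: opnorm_ge0| | |exact: ltW].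
    rewrite subr_ge0; apply: nondecreasing_cvgn_le; last exact: wbound_cvg.
    by apply: nondecreasing_series => k _ _; exact: wbound_ge0.
  by apply: le_trans zr _; rewrite lerDl.
have := tail x xr; have := tail y yr; move: yn.
rewrite !ler_norml !ltr_norml => /andP[h1 h2] /andP[h3 h4] /andP[h5 h6].
by apply/andP; split; lra.
Qed.

Lemma ultra_ball_cvg (F : set_system (bop H)) r : UltraFilter F ->
  F [set y | opnorm y <= r] -> 0 <= r ->
  exists2 x, opnorm x <= r & F --> (x : weak_star H) /\
    forall u v, (fun y : bop H => rinner (y u) v) @ F --> rinner (x u) v.
Proof.
move=> FU Fr r0.
have FP : ProperFilter F by exact: ultra_proper.
have ex u v : {l | (fun y : bop H => rinner (y u) v) @ F --> l &
    `|l| <= r * rnorm u * rnorm v}.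
  apply: cid2; pose c := r * rnorm u * rnorm v.
  have [|l lc Fl] := @ultra_cvg_compact _ _ F (fun y : bop H => rinner (y u) v)
    `[- c, c] _ (@segment_compact _ _ _).
    apply: filterS Fr => y yr /=; rewrite in_itv /= -ler_norml.
    apply: le_trans (rinner_bop_le _ _ _) _.
    by rewrite ler_wpM2r ?rnorm_ge0// ler_wpM2r ?rnorm_ge0.
  by exists l => //; rewrite ler_norml; move: lc; rewrite /= in_itv.
pose l u v := s2val (ex u v).
have lP u v : (fun y : bop H => rinner (y u) v) @ F --> l u v.
  by rewrite /l; case: (ex u v).
have uniq u v (z : R) : (fun y : bop H => rinner (y u) v) @ F --> z -> l u v = z.
  by move=> Fz; apply: (@cvg_unique _ (@Rhausdorff R) _ _ _ _ (lP u v) Fz).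
have [| | | |x xl xr] := @bop_of_form _ _ l r r0.
- move=> a u u' v; apply: uniq.
  under eq_fun do rewrite bopD bopZ rinnerDl rinner_adj.
  by apply: cvgD; exact: lP.
- move=> u v v'; apply: uniq; under eq_fun do rewrite rinnerDr.
  by apply: cvgD; exact: lP.
- move=> s u v; apply: uniq; under eq_fun do rewrite rinnerZr.
  by apply: cvgM; [exact: cvg_cst|exact: lP].
- by move=> u v; rewrite /l; case: (ex u v).
have Fx u v : (fun y : bop H => rinner (y u) v) @ F --> rinner (x u) v.
  by rewrite xl; exact: lP.
by exists x => //; split=> //; exact: cvg_weak_star_ball Fr xr Fx.
Qed.

(** Banach-Alaoglu: along an ultrafilter the matrix coefficients converge to a
    bounded form, which is the form of an operator. *)
Lemma compact_ball_sa (N : set (bop H)) r : closed (N : set (weak_star H)) ->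
  0 <= r -> compact (ball_in (sa_part N) r : set (weak_star H)).
Proof.
move=> Ncl r0; rewrite compact_ultra => F FU FB.
have FP : ProperFilter F by exact: ultra_proper.
have Fr : F [set y | opnorm y <= r] by apply: filterS FB => y [].
have [x xr [Fx Fuv]] := ultra_ball_cvg FU Fr r0.
exists x; split=> //; split=> //; split.
  apply: (closed_cvg (N : set (weak_star H)) Ncl _ _ Fx).
  by apply: filterS FB => y [[]].
apply/selfadjointP => u v.
have h : (fun y : bop H => rinner (y u) v) @ F --> rinner u (x v).
  have := Fuv v u; rewrite rinnerC; apply: cvg_trans; apply: near_eq_cvg.
  apply: filterS FB => y [[_ /selfadjointP ysa] _].
  by rewrite ysa rinnerC.
exact: (@cvg_unique _ (@Rhausdorff R) _ _ _ _ (Fuv u v) h).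
Qed.

Lemma ball_sa_convex (N : set (bop H)) r k k' (t : R) : linear_subspace N ->
  ball_in (sa_part N) r k -> ball_in (sa_part N) r k' -> 0 <= t -> t <= 1 ->
  ball_in (sa_part N) r ((1 - t)%:C%C *: k + t%:C%C *: k').
Proof.
move=> Nlin [[Nk ksa] kr] [[Nk' ksa'] kr'] t0 t1; split; first split.
- by apply: (subspaceD Nlin); exact: (subspaceZ Nlin).
- by apply: selfadjointD; exact: selfadjointZ.
apply: le_trans (opnormD _ _) _.
have -> : r = (1 - t) * r + t * r by ring.
apply: lerD; apply: le_trans (opnormZr _ _) _.
  by rewrite ger0_norm ?subr_ge0// ler_wpM2l ?subr_ge0.
by rewrite ger0_norm// ler_wpM2l.
Qed.

Lemma ball_sa0 (N : set (bop H)) r : linear_subspace N -> 0 <= r ->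
  ball_in (sa_part N) r 0.
Proof.
move=> Nlin r0; split; last by rewrite opnorm0.
by split; [exact: (subspace0 Nlin)|exact: selfadjoint0].
Qed.

Lemma l2delta_subproof (u : H) :
  cvgn (series (fun n => rnorm (if n == 0%N then u else 0) ^+ 2)).
Proof.
apply/cvg_ex; exists (rnorm u ^+ 2).
apply: cvg_near_cst; exists 1%N => // n /= n0; rewrite /series /=.
rewrite big_ltn// big_nat_cond big1 ?addr0// => i /andP[/andP[i0 _] _].
by rewrite gtn_eqF// rnorm0 expr0n.
Qed.

(** With such sequences the normal functionals include the matrix coefficients, so
    they separate operators. *)
Definition l2delta (u : H) : l2seq H :=
  exist (fun z : nat -> H => cvgn (series (fun n => rnorm (z n) ^+ 2)))
    (fun n => if n == 0%N then u else 0) (@l2delta_subproof u).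

Lemma wfun_delta u v x : wfun (l2delta u, l2delta v) x = rinner (x u) v.
Proof.
apply: cvg_lim => //; apply: cvg_near_cst; exists 1%N => // n /= n0.
rewrite /series /= big_ltn// big_nat_cond big1 ?addr0// => i /andP[/andP[i0 _] _].
by rewrite /wterm /= gtn_eqF// rinner0r.
Qed.

Lemma wfun_ext x y : (forall p, wfun p x = wfun p y) -> x = y.
Proof.
by move=> xy; apply: bop_ext => u v; rewrite -!wfun_delta.
Qed.

(** The weak* continuous functionals used for separation. *)
Definition wcomb (s : seq (R * (l2seq H * l2seq H))) x : R :=
  \sum_(q <- s) q.1 * wfun q.2 x.

Lemma wcomb_le s x :
  `|wcomb s x| <= opnorm x * \sum_(q <- s) `|q.1| * limn (series (wbound q.2)).
Proof.
rewrite mulr_sumr; apply: le_trans (ler_norm_sum _ _ _) _.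
apply: ler_sum => q _; rewrite normrM mulrCA ler_wpM2l//.
exact: wfun_le.
Qed.

Lemma wcombB s x y :
  wcomb s (x - y) = wcomb s x - wcomb s y.
Proof.
by rewrite /wcomb -sumrB; apply: eq_bigr => q _; rewrite wfunB mulrBr.
Qed.

Lemma wcombZ s r x : wcomb s (r%:C%C *: x) = r * wcomb s x.
Proof.
by rewrite /wcomb mulr_sumr; apply: eq_bigr => q _; rewrite wfunZ mulrCA.
Qed.

Lemma wbound_sum_ge0 (s : seq (R * (l2seq H * l2seq H))) :
  0 <= \sum_(q <- s) `|q.1| * limn (series (wbound q.2)).
Proof.
apply: sumr_ge0 => q _; rewrite mulr_ge0//.
apply: limr_ge; first exact: wbound_cvg.
by apply: nearW => m; apply: sumr_ge0 => i _; exact: wbound_ge0.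
Qed.

Lemma sqr_sum_eq0 (I : Type) (s : seq I) (d : I -> R) :
  \sum_(i <- s) d i ^+ 2 <= 0 -> \sum_(i <- s) d i ^+ 2 = 0.
Proof.
move=> s0; apply/le_anti; rewrite s0 /=.
by apply: sumr_ge0 => i _; exact: sqr_ge0.
Qed.

(** The first-order condition for a minimum at an end point: divide by [t] and
    let it tend to 0. *)
Lemma slope_le0 (S E : R) : 0 <= E ->
  (forall t, 0 <= t -> t <= 1 -> 2 * t * S <= t ^+ 2 * E) -> S <= 0.
Proof.
move=> E0 h; rewrite leNgt; apply/negP => S0.
have D0 : 0 < E + 1 + S by lra.
have t0 : 0 < S / (E + 1 + S) by rewrite divr_gt0.
have t1 : S / (E + 1 + S) <= 1 by rewrite ler_pdivrMr// mul1r; lra.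
have := h _ (ltW t0) t1.
set t := S / _ in t0 t1 *.
have tS : t * (E + 1 + S) = S by rewrite /t divfK// gt_eqF.
move=> h2; have : t * (2 * S) <= t * (t * E) by lra.
rewrite ler_pM2l//; have := mulr_gt0 t0 S0; move: tS; rewrite !mulrDr mulr1.
lra.
Qed.

(** Hahn-Banach separation from a compact convex set, reduced to Euclidean space:
    a point of [K] minimising a finite sum of squares of [wfun p x - wfun p k] is
    the nearest point for these coordinates, and the hypothesis forces the
    distance to be 0; compactness then handles all coordinates at once. *)
Lemma weak_star_separation (K : set (bop H)) x :
  compact (K : set (weak_star H)) -> K !=set0 ->
  (forall k k' (t : R), K k -> K k' -> 0 <= t -> t <= 1 ->
     K ((1 - t)%:C%C *: k + t%:C%C *: k')) ->
  (forall s c, (forall k, K k -> wcomb s k <= c) -> wcomb s x <= c) ->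
  K x.
Proof.
move=> Kco K0 Kconv Ksep.
pose g (ps : seq (l2seq H * l2seq H)) k :=
  \sum_(p <- ps) (wfun p x - wfun p k) ^+ 2.
have g_cont ps : continuous (g ps : weak_star H -> R).
  elim: ps => [|p ps IH].
    have -> : g [::] = fun=> 0 by apply/funext => k; rewrite /g big_nil.
    exact: cst_continuous.
  have -> : g (p :: ps) =
      (fun k => (wfun p x - wfun p k) * (wfun p x - wfun p k) + g ps k).
    by apply/funext => k; rewrite /g big_cons expr2.
  move=> k; have FF : Filter (nbhs (k : weak_star H)) by exact: nbhs_filter.
  have dc : (fun y => wfun p x - wfun p y) @ nbhs (k : weak_star H) -->
      wfun p x - wfun p k.
    by apply: cvgB; [exact: cvg_cst|exact: wfun_continuous].
  exact: cvgD (cvgM dc dc) (IH k).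
have fin ps : exists2 k, K k & g ps k = 0.
  have [|k0 /set_mem Kk0 k0min] := @compact_EVT_min (weak_star H) R (g ps) K K0 Kco.
    by apply: continuous_subspaceT; exact: g_cont.
  exists k0 => //.
  pose d p := wfun p x - wfun p k0.
  pose s := [seq (d p, p) | p <- ps].
  have sE k : wcomb s k = \sum_(p <- ps) d p * wfun p k.
    by rewrite /wcomb big_map.
  suff h : wcomb s x <= wcomb s k0.
    apply: sqr_sum_eq0.
    move: h; rewrite !sE -subr_le0 -sumrB; under eq_bigr do rewrite -mulrBr.
    by under eq_bigr do rewrite -/(d _) -expr2.
  apply: Ksep => k Kk; rewrite !sE -subr_le0 -sumrB.
  under eq_bigr do rewrite -mulrBr.
  apply: (@slope_le0 _ (\sum_(p <- ps) (wfun p k - wfun p k0) ^+ 2)).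
    by apply: sumr_ge0 => p _; exact: sqr_ge0.
  move=> t t0 t1; have := k0min _ (mem_set (Kconv _ _ t Kk0 Kk t0 t1)).
  move=> h; rewrite /g -subr_ge0 -sumrB in h.
  rewrite !mulr_sumr -subr_ge0 -sumrB (le_trans h)// le_eqVlt.
  apply/orP; left; apply/eqP; apply: eq_bigr => p _.
  by rewrite wfunD !wfunZ /d; ring.
pose B ps := [set k | K k /\ g ps k = 0].
pose F := filter_from [set: seq (l2seq H * l2seq H)] B.
have FP : ProperFilter F.
  apply: filter_from_proper.
    apply: filter_from_filter; first by exists [::].
    move=> ps ps' _ _; exists (ps ++ ps') => // k [Kk gk].
    have g0 qs : 0 <= g qs k by apply: sumr_ge0 => p _; exact: sqr_ge0.
    have : g ps k + g ps' k = 0 by rewrite -gk /g big_cat.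
    by move=> /eqP; rewrite paddr_eq0// => /andP[/eqP ? /eqP ?].
  by move=> ps _; have [k Kk gk] := fin ps; exists k.
have [|k [Kk]] := Kco F FP.
  by exists [::] => // k [].
rewrite clusterE => kcl; suff -> : x = k by [].
apply: wfun_ext => p.
have cl : closed ([set y | wfun p y = wfun p x] : set (weak_star H)).
  apply: (@preimage_closed _ _ (wfun p : weak_star H -> R) [set z | z = wfun p x]).
    by move=> y _; exact: wfun_continuous.
  exact: closed_eq.
suff : [set y | wfun p y = wfun p x] k by [].
apply: cl; apply: closureS (kcl (B [:: p]) _); last by exists [:: p].
move=> y [_ /=]; rewrite /g big_seq1 => /eqP; rewrite sqrf_eq0 subr_eq0.
by move=> /eqP.
Qed.

End WeakStarCompactness.

(** * Bounded lifts along Jordan homomorphisms *)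

Section PolynomialClamp.
Context {R : realType} {H : hilbertType R}.
Implicit Types (x y h : bop H) (r : R) (p q g : {poly R}) (i n N : nat).

Lemma peval_comp y g q : peval (peval y g) q = peval y (q \Po g).
Proof.
elim/poly_ind: q => [|q c IH]; first by rewrite comp_poly0 !raddf0.
by rewrite comp_poly_MXaddC !raddfD /= pevalMX IH !pevalC rmorphM.
Qed.

(** Iterate [y ^ 2 <= (1 + y ^ 4) / 2]. *)
Lemma positive_sq_le_pow y i : selfadjoint y ->
  positive_op (peval y (1 + 'X^(2 ^ i.+1) - 'X^2)).
Proof.
elim: i y => [|i IH] y ysa.
  by rewrite expn1 addrK rmorph1; exact: positive1.
have y2sa := selfadjointX 2 ysa.
have -> : 1 + 'X^(2 ^ i.+2) - 'X^2 = 2^-1 *: ((1 + 'X^(2 ^ i.+2) - 'X^4) +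
    ((1 - 'X^2) ^+ 2 * 1 + 'X^(2 ^ i.+1) ^+ 2 * 1)) :> {poly R}.
  have -> : 'X^(2 ^ i.+2) = 'X^(2 ^ i.+1) ^+ 2 :> {poly R}.
    by rewrite -exprM expnSr.
  rewrite -mul_polyC; apply: (@mulfI _ 2%:P); first by rewrite polyC_eq0.
  rewrite mulrA -polyCM mulfV// mul1r polyC_natr; ring.
have one : positive_op (peval y 1) by rewrite rmorph1; exact: positive1.
rewrite pevalZ; apply: positiveZ; rewrite ?invr_ge0// rmorphD.
apply: positiveD; last first.
  by rewrite rmorphD; apply: positiveD; exact: positive_pevalM2.
have := IH _ y2sa; have {1}-> : y ^+ 2 = peval y 'X^2.
  by rewrite rmorphXn /= pevalX1.
rewrite peval_comp comp_polyB comp_polyD (rmorph1 (comp_poly _)) !comp_Xn_poly.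
rewrite -!exprM.
by rewrite -expnS.
Qed.

Section UnitInterval.
Variable w : bop H.
Hypotheses (w0 : positive_op w) (w1 : positive_op (1 - w)).

Let pB i j : positive_op (peval w ('X ^+ i * (1 - 'X) ^+ j)).
Proof. exact: positive_peval_bernstein. Qed.

Lemma positive_1_sub_pow n : positive_op (peval w (1 - 'X^n)).
Proof.
elim: n => [|n IH]; first by rewrite expr0 subrr raddf0; exact: positive0.
have -> : 1 - 'X^(n.+1) = (1 - 'X^n) + 'X ^+ n * (1 - 'X) ^+ 1 :> {poly R}.
  by rewrite exprSr; ring.
by rewrite rmorphD; apply: positiveD; [exact: IH|exact: pB].
Qed.

(** The operator form of Bernoulli's inequality [(1 + N s) (1 - s) ^ N <= 1], at
    [s = 1 - w]. *)
Lemma positive_bernoulli m N :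
  positive_op (peval w ('X^m * (1 - (1 + N%:R * (1 - 'X)) * 'X^N))).
Proof.
elim: N => [|N IH].
  by rewrite mul0r addr0 expr0 mulr1 subrr mulr0 raddf0; exact: positive0.
have -> : 'X^m * (1 - (1 + N.+1%:R * (1 - 'X)) * 'X^(N.+1)) =
   'X^m * (1 - (1 + N%:R * (1 - 'X)) * 'X^N) +
     N.+1%:R *: ('X ^+ (m + N) * (1 - 'X) ^+ 2) :> {poly R}.
  by rewrite -mul_polyC polyC_natr exprD exprSr -natr1; ring.
rewrite rmorphD /= pevalZ; apply: positiveD; first exact: IH.
by apply: positiveZ; [|exact: pB].
Qed.

Lemma positive_1_sub_bernoulli N :
  positive_op (peval w (1 - (1 + N%:R * (1 - 'X)) * 'X^(2 * N))).
Proof.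
have -> : 1 - (1 + N%:R * (1 - 'X)) * 'X^(2 * N) = (1 - 'X^N) +
    'X^N * (1 - (1 + N%:R * (1 - 'X)) * 'X^N) :> {poly R}.
  by rewrite mul2n -addnn exprD; ring.
rewrite rmorphD; apply: positiveD; first exact: positive_1_sub_pow.
exact: positive_bernoulli.
Qed.

End UnitInterval.

(** A polynomial substitute for truncation to [-1, 1]: it is [X] times an
    approximation of [exp (- X ^ (2 ^ i.+1))], hence close to [X] near 0, and at
    most 1 on the interval where [X ^ (2 ^ i.+1) <= N]. *)
Definition clamp_factor i N : {poly R} := 1 - N%:R^-1 *: 'X^(2 ^ i.+1).
Definition clamp i N : {poly R} := 'X * clamp_factor i N ^+ N.

Lemma pow2_even y i : y ^+ (2 ^ i.+1) = (y ^+ (2 ^ i)) ^+ 2.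
Proof. by rewrite -exprM expnSr. Qed.

Lemma peval_clamp_factor y i N :
  peval y (clamp_factor i N) = 1 - N%:R^-1%:C%C *: y ^+ (2 ^ i.+1).
Proof.
by rewrite rmorphB rmorph1 /= pevalZ [peval y _]rmorphXn /= pevalX1.
Qed.

Lemma clamp_factor_bounds y i N : selfadjoint y -> (0 < N)%N ->
  opnorm (y ^+ (2 ^ i.+1)) <= N%:R ->
  positive_op (peval y (clamp_factor i N)) /\
  positive_op (1 - peval y (clamp_factor i N)).
Proof.
move=> ysa N0 yN; rewrite peval_clamp_factor.
have Ni : 0 <= N%:R^-1 :> R by rewrite invr_ge0.
have hsa := selfadjointX (2 ^ i.+1) ysa.
split.
  have -> : 1 - N%:R^-1%:C%C *: y ^+ (2 ^ i.+1) =
      N%:R^-1%:C%C *: (N%:R%:S - y ^+ (2 ^ i.+1)).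
    rewrite scalerBr scalerA -rmorphM mulVf ?scale1r//.
    by rewrite pnatr_eq0 -lt0n.
  by apply: positiveZ => //; exact: positive_opnorm.
rewrite opprB addrC subrK; apply: positiveZ => //.
by rewrite pow2_even; apply: positive_sq; exact: selfadjointX.
Qed.

(** Let [g] be the factor of [clamp i N] and [h = X ^ (2 ^ i.+1) = N (1 - g)]. Then
    [1 - (X g ^ N) ^ 2] is the sum of [g ^ (2 N) (1 + h - X ^ 2)], positive because
    [X ^ 2 <= 1 + h], and of [1 - (1 + N (1 - g)) g ^ (2 N)], positive by
    Bernoulli's inequality. *)
Lemma opnorm_clamp y i N : selfadjoint y -> (0 < N)%N ->
  opnorm (y ^+ (2 ^ i.+1)) <= N%:R -> opnorm (peval y (clamp i N)) <= 1.
Proof.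
move=> ysa N0 yN; have [g0 g1] := clamp_factor_bounds ysa N0 yN.
apply: opnorm_sq_le => //; first exact: peval_selfadjoint.
rewrite expr1n rmorph1 scale1r.
set g := clamp_factor i N in g0 g1 *.
have N0' : N%:R != 0 :> R by rewrite pnatr_eq0 -lt0n.
have gE : N%:R * (1 - g) = 'X^(2 ^ i.+1) :> {poly R}.
  rewrite /g /clamp_factor opprB addrC subrK -polyC_natr mul_polyC scalerA.
  by rewrite mulfV// scale1r.
have -> : 1 - peval y (clamp i N) ^+ 2 = peval y
    ((g ^+ N) ^+ 2 * (1 + 'X^(2 ^ i.+1) - 'X^2) +
     ((1 - (1 + N%:R * (1 - 'X)) * 'X^(2 * N)) \Po g)).
  rewrite -rmorphXn -[1 in LHS](rmorph1 (peval y)) -rmorphB; congr peval.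
  rewrite comp_polyB comp_polyM comp_polyD comp_polyM comp_polyB comp_polyX.
  rewrite comp_Xn_poly (rmorph1 (comp_poly _)) (rmorph_nat (comp_poly _)) gE.
  rewrite /clamp -/g mulnC exprM; ring.
rewrite rmorphD /= -peval_comp; apply: positiveD.
  by apply: positive_pevalM2 => //; exact: positive_sq_le_pow.
exact: positive_1_sub_bernoulli.
Qed.

Lemma opnorm_1_sub_pow (w : bop H) n : opnorm w <= 1 ->
  opnorm (1 - w ^+ n) <= n%:R * opnorm (1 - w).
Proof.
move=> w1; elim: n => [|n IH]; first by rewrite expr0 subrr opnorm0 mul0r.
have -> : 1 - w ^+ n.+1 = (1 - w) + (1 - w ^+ n) * w.
  by rewrite mulrBl mul1r -exprSr addrA subrK.
apply: le_trans (opnormD _ _) _.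
rewrite -natr1 [leRHS]mulrDl mul1r [leLHS]addrC lerD2r; apply: le_trans IH.
apply: le_trans (opnormM _ _) _.
by rewrite -[leRHS]mulr1 ler_wpM2l ?opnorm_ge0.
Qed.

(** The relative error [1 - (1 - h / N) ^ N], with [h = x ^ (2 ^ i.+1)], is bounded
    by the norm of [h], which is at most [2 ^ - (2 ^ i.+1)]. *)
Lemma clamp_error x i N : selfadjoint x -> (0 < N)%N -> opnorm x <= 2^-1 ->
  opnorm (x - peval x (clamp i N)) <= i.+1%:R^-1.
Proof.
move=> xsa N0 xh.
have N1 : 1 <= N%:R :> R by rewrite ler1n.
have h2 : (2^-1 : R) <= 1 by rewrite invf_le1// ler1n.
have hx : opnorm (x ^+ (2 ^ i.+1)) <= i.+1%:R^-1.
  apply: le_trans (opnormX _ _) _.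
  apply: (@le_trans _ _ (2^-1 ^+ (2 ^ i.+1))).
    by rewrite lerXn2r ?nnegrE ?opnorm_ge0// invr_ge0.
  rewrite exprVn lef_pV2 ?posrE ?exprn_gt0// ?ltr0n//.
  rewrite -natrX ler_nat; apply: leq_trans (ltnW (ltn_expl _ (ltnSn 1))).
  exact/ltnW/ltn_expl.
have hxN : opnorm (x ^+ (2 ^ i.+1)) <= N%:R.
  by apply: le_trans hx _; apply: le_trans N1; rewrite invf_le1 ?ltr0n// ler1n.
have [g0 g1] := clamp_factor_bounds xsa N0 hxN.
set w := peval x (clamp_factor i N) in g0 g1.
have w1 : opnorm w <= 1.
  apply: opnorm_le_positive => //; rewrite rmorph1 scale1r//.
  by apply: positiveD => //; exact: positive1.
have -> : x - peval x (clamp i N) = x * (1 - w ^+ N).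
  by rewrite mulrBr mulr1 /clamp rmorphM rmorphXn /= pevalX1.
apply: le_trans (opnormM _ _) _; apply: le_trans hx.
rewrite -[leRHS]mul1r; apply: ler_pM; rewrite ?opnorm_ge0//.
  exact: le_trans xh h2.
apply: le_trans (opnorm_1_sub_pow N w1) _.
rewrite /w peval_clamp_factor opprB addrC subrK.
rewrite -ler_pdivlMl ?ltr0n// (le_trans (opnormZr _ _))//.
by rewrite ger0_norm ?invr_ge0.
Qed.

End PolynomialClamp.

Section TailContainsCore.
Context {R : realType} {H : hilbertType R}.
Variables (M : set (bop H)) (phi : bop H -> bop H).
Hypothesis M_vna : von_neumann_algebra M.
Hypothesis phi_UP : UP_map M M phi.
Implicit Types (x y z h : bop H) (r : R).

Lemma compact_iter_image (K : set (bop H)) n : K `<=` M ->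
  compact (K : set (weak_star H)) ->
  compact (iter n phi @` K : set (weak_star H)).
Proof.
move=> KM Kco; elim: n => [|n IH]; first by rewrite image_id.
have -> : iter n.+1 phi @` K = phi @` (iter n phi @` K).
  by rewrite -image_comp.
apply: (@continuous_compact (weak_star H) (weak_star H)) => //.
have [_ _ _ _ phi_cont] := phi_UP.
apply: continuous_subspaceW phi_cont => _ [x Kx <-].
by apply: (iter_phiM phi_UP); exact: KM.
Qed.

(** Powers of [phi] preserve polynomials in [y]. Truncating the lift [y] by the
    clamping polynomials therefore gives approximate lifts of [x] of norm at most
    1, and the image of the unit ball is weak* compact, which makes the error
    disappear. *)
Lemma bounded_lift n x y : orbit_definite_set M phi y -> selfadjoint y ->
  iter n phi y = x -> opnorm x <= 2^-1 ->
  exists2 z, ball_in (sa_part M) 1 z & iter n phi z = x.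
Proof.
move=> By ysa yx xh; have [My _] := By.
have Mlin := vna_lin M_vna.
have lin := iter_phi_lin phi_UP n.
have xsa : selfadjoint x.
  by rewrite -yx; apply: (pu_selfadjoint Mlin (vna1 M_vna) (iter_phi_pu phi_UP n)).
have Mcl : closed (M : set (weak_star H)) by case: M_vna => -[].
have : (iter n phi @` ball_in (sa_part M) 1) x.
  apply: weak_star_separation.
  - apply: compact_iter_image; first by move=> k [[]].
    exact: compact_ball_sa.
  - by exists (iter n phi 0), 0 => //; exact: ball_sa0.
  - move=> _ _ t [k kB <-] [k' kB' <-] t0 t1.
    exists ((1 - t)%:C%C *: k + t%:C%C *: k'); first exact: ball_sa_convex.
    have [[[Mk _] _] [[Mk' _] _]] := (kB, kB').
    rewrite lin//; last exact: (subspaceZ Mlin).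
    by rewrite (linear_onZ Mlin lin).
  move=> s c sc; pose C := \sum_(q <- s) `|q.1| * limn (series (wbound q.2)).
  have C0 : 0 <= C by exact: wbound_sum_ge0.
  have approx i : wcomb s x <= c + i.+1%:R^-1 * C.
    pose N := (Num.truncn (opnorm (y ^+ (2 ^ i.+1)))).+1.
    have yN : opnorm (y ^+ (2 ^ i.+1)) <= N%:R by exact/ltW/truncnS_gt.
    pose z := peval y (clamp i N).
    have Mz : M z by apply: (subspace_peval Mlin) => m; exact: (vnaX M_vna).
    have zB : ball_in (sa_part M) 1 z.
      split; first by split=> //; exact: peval_selfadjoint.
      exact: opnorm_clamp.
    have := sc _ (imageP (iter n phi) zB).
    rewrite /z (orbit_iter_peval M_vna phi_UP)// yx.
    have := clamp_error i xsa (isT : (0 < N)%N) xh.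
    move=> /(ler_wpM2r C0); have := wcomb_le s (x - peval x (clamp i N)).
    rewrite wcombB -/C ler_norml => /andP[_ h1] h2 h3.
    rewrite -lerBlDl; apply: le_trans h2; apply: le_trans h1.
    by rewrite lerD2l lerN2.
  apply/ler_addgt0Pr => e e0.
  have [i _ /(_ i (leqnn i)) iP] :=
    near_infty_natSinv_lt (PosNum (divr_gt0 e0 (ltr_wpDl C0 ltr01))).
  apply: le_trans (approx i) _; rewrite lerD2l.
  move: iP => /=; rewrite ltr_pdivlMr ?ltr_wpDl// => iP.
  have i0 : 0 <= i.+1%:R^-1 :> R by rewrite invr_ge0.
  by apply: le_trans (ltW iP); rewrite mulrDr mulr1 lerDl.
by move=> [z zB zx]; exists z.
Qed.

(** The radius of the lifts must not depend on [n]: rescale the real and imaginary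
    parts of [x] to norm at most [1 / 2] and lift each of them to the unit ball. *)
Lemma multiplicative_core_tail :
  multiplicative_core M phi `<=` tail_system M phi.
Proof.
move=> x xC; pose t := (2 * (opnorm x + 1))^-1.
have x0 := opnorm_ge0 x.
have D0 : 0 < 2 * (opnorm x + 1) by rewrite mulr_gt0// ltr_wpDl.
have t0 : 0 < t by rewrite invr_gt0.
have small a : opnorm a <= opnorm x -> opnorm (t%:C%C *: a) <= 2^-1.
  move=> ax; apply: le_trans (opnormZr _ _) _; rewrite (ger0_norm (ltW t0)).
  apply: (@le_trans _ _ (t * (opnorm x + 1))).
    by rewrite ler_pM2l//; apply: le_trans ax _; rewrite lerDl.
  by rewrite /t invfM -mulrA mulVf ?mulr1// gt_eqF// ltr_wpDl.
exists (t^-1 * 2); first by rewrite /= mulr_gt0// invr_gt0.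
move=> n n0; have [y yB yx] := xC n n0.
have Mlin := vna_lin M_vna; have lin := iter_phi_lin phi_UP n.
have Blin := orbit_lin M_vna phi_UP.
have Bre : orbit_definite_set M phi (re_op y).
  by apply: (subspace_re Blin) => //; exact: (orbit_adjoint M_vna phi_UP).
have Bim : orbit_definite_set M phi (im_op y).
  by apply: (subspace_im Blin) => //; exact: (orbit_adjoint M_vna phi_UP).
have My : M y by case: yB.
have Ma : M (adjoint y) by exact: (vna_adj M_vna).
have iter_pu := iter_phi_pu phi_UP n.
have reE : iter n phi (re_op y) = re_op x.
  by rewrite (pu_re Mlin (vna1 M_vna) iter_pu)// yx.
have imE : iter n phi (im_op y) = im_op x.
  by rewrite (pu_im Mlin (vna1 M_vna) iter_pu)// yx.
have lift a b : orbit_definite_set M phi a -> selfadjoint a ->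
    iter n phi a = b -> opnorm b <= opnorm x ->
    exists2 z, ball_in (sa_part M) 1 z & iter n phi z = t%:C%C *: b.
  move=> Ba asa ab bx; apply: (bounded_lift (y := t%:C%C *: a)).
  - exact: (subspaceZ Blin).
  - exact: selfadjointZ.
  - by rewrite (linear_onZ Mlin lin) ?ab//; case: Ba.
  - exact: small.
have [z1 [[Mz1 _] z11] z1E] := lift _ _ Bre (selfadjoint_re y) reE (opnorm_re x).
have [z2 [[Mz2 _] z21] z2E] := lift _ _ Bim (selfadjoint_im y) imE (opnorm_im x).
have Miz2 : M ('i%C *: z2) by exact: (subspaceZ Mlin).
have Mz : M (z1 + 'i%C *: z2) by exact: (subspaceD Mlin).
exists (t^-1%:C%C *: (z1 + 'i%C *: z2)).
  split; first exact: (subspaceZ Mlin).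
  apply: le_trans (opnormZr _ _) _.
  have ti0 : 0 < t^-1 by rewrite invr_gt0.
  rewrite (ger0_norm (ltW ti0)).
  rewrite ler_pM2l ?invr_gt0//; apply: le_trans (opnormD _ _) _.
  have := opnormZ 'i%C z2; rewrite norm_i /= mul1r; lra.
rewrite (linear_onZ Mlin lin)// (linear_onD lin)// (linear_onZ Mlin lin 'i%C)//.
have sw : 'i%C *: (t%:C%C *: im_op x) = t%:C%C *: ('i%C *: im_op x).
  by rewrite [LHS]scalerA [RHS]scalerA mulrC.
rewrite z1E z2E sw -scalerDr -re_imE scalerA -rmorphM mulVf ?gt_eqF//.
by rewrite scale1r.
Qed.

End TailContainsCore.

(** * Hermitian normal functionals *)

Section HermitianNormalFunctionals.
Context {R : realType} {H : hilbertType R}.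
Implicit Types (x y z : bop H) (p : l2seq H * l2seq H).

Lemma normal_functional_linear p (a : R[i]) x y :
  normal_functionals (a *: x + y) p =
  a * normal_functionals x p + normal_functionals y p.
Proof.
rewrite /normal_functionals.
have cx := cvgP _ (@normal_functional_cvg _ _ p x).
have cy := cvgP _ (@normal_functional_cvg _ _ p y).
rewrite -[X in _ = X + _](@lim_seriesZ R[i] _ a cx).
rewrite -(@lim_seriesD R[i] _ _ (@is_cvg_seriesZ R[i] _ a cx) cy).
congr (limn (series _)); apply/funext => n.
by rewrite fctE !bopE linearDl linearZl_LR.
Qed.

Definition pswap p : l2seq H * l2seq H := (p.2, p.1).

Lemma normal_functional_swap p z : selfadjoint z ->
  normal_functionals z p + normal_functionals z (pswap p) = (2 * wfun p z)%:C%C.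
Proof.
move=> /selfadjointP zsa; rewrite !normal_functionalE.
have -> : wfun (pswap p) z = wfun p z.
  congr (limn (series _)); apply/funext => n.
  by rewrite /wterm /= zsa rinnerC.
have -> : wfun (irot (pswap p)) z = - wfun (irot p) z.
  rewrite /wfun -lim_seriesN; last exact: wterm_cvg.
  congr (limn (series _)); apply/funext => n.
  rewrite fctE /wterm /= zsa bopZ rinnerC rinner_adj conj_i scaleNr rinnerNr.
  by [].
by apply/eqP; rewrite eq_complex /= subrr eqxx andbT mulr_natl mulr2n.
Qed.

(** Elements of the predual are complex linear, whereas separation produces real
    combinations. Averaging each functional with its adjoint gives an element of
    the predual that agrees with [wcomb s] on self-adjoint operators. *)
Definition herm_functional (s : seq (R * (l2seq H * l2seq H))) z : R[i] :=
  \sum_(q <- s) (q.1 / 2)%:C%C *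
    (normal_functionals z q.2 + normal_functionals z (pswap q.2)).

Lemma herm_functionalE s z : selfadjoint z ->
  herm_functional s z = (wcomb s z)%:C%C.
Proof.
move=> zsa; rewrite /herm_functional /wcomb rmorph_sum /=.
apply: eq_bigr => q _; rewrite normal_functional_swap// -rmorphM.
by rewrite mulrA divfK.
Qed.

Lemma herm_functional_predual (M : set (bop H)) s :
  predual M (herm_functional s).
Proof.
split.
  move=> a x y _ _; rewrite /herm_functional scaler_sumr -big_split /=.
  apply: eq_bigr => q _; rewrite !normal_functional_linear /GRing.scale /=; ring.
apply: continuous_subspaceT.
elim: s => [|q s IH].
  have -> : herm_functional [::] = fun=> 0.
    by apply/funext => z; rewrite /herm_functional big_nil.
  exact: cst_continuous.
have -> : herm_functional (q :: s) = fun z => (q.1 / 2)%:C%C *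
    (normal_functionals z q.2 + normal_functionals z (pswap q.2)) +
    herm_functional s z.
  by apply/funext => z; rewrite /herm_functional big_cons.
move=> k; have FF : Filter (nbhs (k : weak_star H)) by exact: nbhs_filter.
have c p := @normal_functional_continuous _ _ p k.
have cs : (fun z => normal_functionals z q.2 + normal_functionals z (pswap q.2)
      : R[i]^o) @ nbhs (k : weak_star H) -->
    (normal_functionals k q.2 + normal_functionals k (pswap q.2) : R[i]^o).
  by apply: cvgD; exact: c.
have cc : (fun _ : weak_star H => (q.1 / 2)%:C%C : R[i]^o) @
    nbhs (k : weak_star H) --> ((q.1 / 2)%:C%C : R[i]^o) by exact: cvg_cst.
exact: (cvgD (cvgM cc cs) (IH k)).
Qed.

End HermitianNormalFunctionals.

(** * Embedded asymptotic lifts *)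

Section EmbeddedLift.
Context {R : realType} {H : hilbertType R}.
Variables (M : set (bop H)) (phi : bop H -> bop H).
Hypothesis M_vna : von_neumann_algebra M.
Hypothesis phi_UP : UP_map M M phi.
Variables (K : hilbertType R) (N : set (bop K)).
Variables (alpha : bop K -> bop K) (E : bop K -> bop H).
Hypothesis lift : asymptotic_lift M phi N alpha E.
Hypothesis E_isometric :
  forall y, N y -> selfadjoint y -> opnorm (E y) = opnorm y.
Implicit Types (r : R) (x : bop H) (y : bop K).

Let beta := inverse_on N alpha.
Let T := tail_system M phi.

Let N_sys : dual_operator_system N. Proof. by case: lift => -[]. Qed.
Let Nlin : linear_subspace N. Proof. by case: N_sys. Qed.
Let N1 : N 1. Proof. by case: N_sys. Qed.
Let Nadj y : N y -> N (adjoint y). Proof. by case: N_sys => _ _ + _; apply. Qed.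
Let Ncl : closed (N : set (weak_star K)). Proof. by case: N_sys. Qed.
Let Mlin := vna_lin M_vna.
Let M1 := vna1 M_vna.
Let alpha_UP : UP_map N N alpha. Proof. by case: lift => -[_ []]. Qed.
Let beta_UP : UP_map N N beta. Proof. by case: lift => -[_ []]. Qed.
Let alpha_bij : set_bij N N alpha. Proof. by case: lift => -[_ []]. Qed.
Let E_UP : UP_map N M E. Proof. by case: lift => -[]. Qed.
Let E_lin : linear_on N E. Proof. by case: E_UP. Qed.
Let E_pu : positive_unital N E. Proof. by case: E_UP. Qed.
Let beta_pu : positive_unital N beta. Proof. by case: beta_UP. Qed.
Let beta_lin : linear_on N beta. Proof. by case: beta_UP. Qed.

Let E_alpha y : N y -> E (alpha y) = phi (E y).
Proof. by case: lift => -[_ _ _ +] _ _; apply. Qed.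

Let N_alpha y : N y -> N (alpha y).
Proof. by case: alpha_UP => + _ _ _ _; apply. Qed.

Let N_beta y : N y -> N (beta y).
Proof. by case: beta_UP => + _ _ _ _; apply. Qed.

Let M_E y : N y -> M (E y).
Proof. by case: E_UP => + _ _ _ _; apply. Qed.

Let alphaK y : N y -> beta (alpha y) = y.
Proof.
move=> Ny; apply: pinvKV; rewrite ?inE//.
by case: alpha_bij.
Qed.

Let betaK y : N y -> alpha (beta y) = y.
Proof.
move=> Ny; apply: (@surjpK _ _ _ N N alpha); rewrite ?inE//.
by case: alpha_bij.
Qed.

Let N_iter_beta n y : N y -> N (iter n beta y).
Proof. by move=> Ny; elim: n => // n IH /=; exact: N_beta. Qed.

Lemma iter_phi_E_beta n y : N y -> iter n phi (E (iter n beta y)) = E y.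
Proof.
move=> Ny; elim: n => // n IH.
by rewrite iterSr /= -E_alpha ?betaK//; [exact: N_iter_beta|exact/N_beta/N_iter_beta].
Qed.

Lemma E_iter_beta_pu n : positive_unital N (E \o iter n beta).
Proof.
split.
- move=> a y z Ny Nz /=.
  have -> : iter n beta (a *: y + z) = a *: iter n beta y + iter n beta z.
    elim: n => // n IH /=; rewrite IH beta_lin//; exact: N_iter_beta.
  by apply: E_lin; exact: N_iter_beta.
- rewrite /=; have -> : iter n beta 1 = 1.
    by elim: n => // n IH /=; rewrite IH; case: beta_pu.
  by case: E_pu.
- move=> y Ny y0 /=; case: E_pu => _ _; apply; first exact: N_iter_beta.
  elim: n => // n IH /=; case: beta_pu => _ _; apply => //; exact: N_iter_beta.
Qed.

(** [E y = phi ^ n (E (beta ^ n y))], where [beta] is the inverse of [alpha], and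
    positive unital maps at most double the norm. *)
Lemma E_tail y : N y -> T (E y).
Proof.
move=> Ny; exists (2 * opnorm y + 1).
  by rewrite /= ltr_wpDl// mulr_ge0// opnorm_ge0.
move=> n _; exists (E (iter n beta y)); last exact: iter_phi_E_beta.
split; first exact/M_E/N_iter_beta.
apply: (@le_trans _ _ (2 * opnorm y)); last by rewrite lerDl.
exact: (pu_opnorm2 Nlin N1 (E_iter_beta_pu n) Ny (Nadj Ny)).
Qed.

Lemma tail_adjoint x : T x -> T (adjoint x).
Proof.
move=> [r r0 xr]; exists r => // n n0; have [y [My yr] <-] := xr n n0.
exists (adjoint y); last exact: (iter_phi_adjoint M_vna phi_UP).
split; first exact: (vna_adj M_vna).
exact: le_trans (opnorm_adjoint y) yr.
Qed.

(** The defining norm formula of an asymptotic lift says that a normal functional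
    is no larger at [x] than on the image of the ball of [N], since [x] has
    preimages of bounded norm under all powers of [phi]; this image being weak*
    compact and convex, it contains [x]. *)
Lemma tail_sa_sub_E x : T x -> selfadjoint x ->
  exists y, [/\ N y, selfadjoint y & E y = x].
Proof.
move=> [r r0 xr] xsa.
suff [y [[Ny ysa] _] yx] : (E @` ball_in (sa_part N) r) x by exists y.
have convB := fun k k' t => @ball_sa_convex _ K N r k k' t Nlin.
apply: weak_star_separation.
- apply: (@continuous_compact (weak_star K) (weak_star H)).
    have [_ _ _ _ E_cont] := E_UP.
    by apply: continuous_subspaceW E_cont => y [[]].
  by apply: compact_ball_sa => //; exact: ltW.
- by exists (E 0), 0 => //; apply: ball_sa0 => //; exact: ltW.
- move=> _ _ t [k kB <-] [k' kB' <-] t0 t1.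
  exists ((1 - t)%:C%C *: k + t%:C%C *: k'); first exact: convB.
  have [[[Nk _] _] [[Nk' _] _]] := (kB, kB').
  rewrite E_lin//; last exact: (subspaceZ Nlin).
  by rewrite (linear_onZ Nlin E_lin).
move=> s c sc.
have rho_pred := herm_functional_predual M s.
set rho := herm_functional s in rho_pred.
have rhoE z : selfadjoint z -> rnorm (rho z : R[i]^o) = `|wcomb s z|.
  by move=> zsa; rewrite /rho herm_functionalE// /rnorm Re_norm_realC.
pose C := \sum_(q <- s) `|q.1| * limn (series (wbound q.2)).
have C0 : 0 <= C by exact: wbound_sum_ge0.
have low k : (0 < k)%N -> `|wcomb s x| / r <= norm_on_sa M (rho \o iter k phi).
  move=> k0; have [y [My yr] yx] := xr k k0.
  have pu := iter_phi_pu phi_UP k.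
  have Ma : M (adjoint y) by exact: (vna_adj M_vna).
  have Mr : M (re_op y) by exact: (vna_re M_vna).
  have sa_iter z : M z -> selfadjoint z -> selfadjoint (iter k phi z).
    exact: (pu_selfadjoint Mlin M1 pu).
  have rx : iter k phi (re_op y) = x.
    by rewrite (pu_re Mlin M1 pu)// yx /re_op xsa double_scaler2.
  apply: ub_le_sup.
    exists C => _ [z [[Mz zsa] z1] <-] /=; rewrite rhoE; last exact: sa_iter.
    apply: le_trans (wcomb_le s _) _; rewrite -[leRHS]mul1r ler_wpM2r//.
    by apply: le_trans z1; exact: (pu_opnorm Mlin M1 pu).
  exists (r^-1%:C%C *: re_op y).
    split; first split.
    - exact: (subspaceZ Mlin).
    - by apply: selfadjointZ; exact: selfadjoint_re.
    apply: le_trans (opnormZr _ _) _; rewrite ger0_norm ?invr_ge0 ?(ltW r0)//.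
    by rewrite ler_pdivrMl// mulr1; exact: le_trans (opnorm_re y) yr.
  have [lin _ _] := pu.
  rewrite /= (linear_onZ Mlin lin)// rx rhoE; last exact: selfadjointZ.
  rewrite wcombZ normrM ger0_norm ?invr_ge0 ?(ltW r0)//.
  by rewrite mulrC.
have lowN : `|wcomb s x| / r <= norm_on_sa N (rho \o E).
  have [_ _ /(_ rho rho_pred) cv] := lift.
  rewrite -(cvg_lim _ cv)//; apply: limr_ge; first by apply/cvg_ex; eexists; exact: cv.
  by exists 1%N => // k; exact: low.
have upN : norm_on_sa N (rho \o E) <= c / r.
  apply: ge_sup.
    by exists (rnorm (rho (E 0) : R[i]^o)), 0 => //; apply: ball_sa0.
  move=> _ [y [[Ny ysa] y1] <-] /=.
  rewrite rhoE; last exact: (pu_selfadjoint Nlin N1 E_pu).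
  rewrite ler_pdivlMr//.
  have sgn (e : R) : `|e| = 1 -> e * r * wcomb s (E y) <= c.
    move=> e1; rewrite -wcombZ -(linear_onZ Nlin E_lin)//; apply: sc.
    exists ((e * r)%:C%C *: y) => //; split; first split.
    - exact: (subspaceZ Nlin).
    - exact: selfadjointZ.
    apply: le_trans (opnormZr _ _) _; rewrite normrM e1 mul1r (ger0_norm (ltW r0)).
    by rewrite -[leRHS]mulr1 ler_pM2l.
  have := sgn 1 (normr1 _); have := sgn (-1) (normrN1 _).
  rewrite mulN1r mul1r mulNr => h1 h2.
  have [w0|w0] := leP 0 (wcomb s (E y)).
    by rewrite ger0_norm// mulrC.
  by rewrite ltr0_norm// mulrC mulrN.
have := le_trans lowN upN; rewrite ler_pM2r ?invr_gt0// => h.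
exact: le_trans (ler_norm _) h.
Qed.

Lemma tail_sub_E x : linear_subspace T -> T x -> exists2 y, N y & E y = x.
Proof.
move=> Tlin Tx; have Ta := tail_adjoint Tx.
have Tr : T (re_op x) by exact: (subspace_re Tlin).
have Ti : T (im_op x) by exact: (subspace_im Tlin).
have [y [Ny _ yE]] := tail_sa_sub_E Tr (selfadjoint_re x).
have [z [Nz _ zE]] := tail_sa_sub_E Ti (selfadjoint_im x).
exists (y + 'i%C *: z).
  by apply: (subspaceD Nlin) => //; exact: (subspaceZ Nlin).
rewrite (linear_onD E_lin)//; last exact: (subspaceZ Nlin).
by rewrite (linear_onZ Nlin E_lin)// yE zE -re_imE.
Qed.

(** The isometry is only given on self-adjoint elements, but the kernel of [E] is
    stable under real and imaginary parts. *)
Lemma E_inj : {in N &, injective E}.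
Proof.
move=> y z /set_mem Ny /set_mem Nz yz; apply/eqP; rewrite -subr_eq0; apply/eqP.
have Nd : N (y - z) by exact: (subspaceB Nlin).
have Ed : E (y - z) = 0 by rewrite (linear_onB Nlin E_lin)// yz subrr.
have Nda := Nadj Nd.
have zero w : N w -> selfadjoint w -> E w = 0 -> w = 0.
  by move=> Nw wsa Ew; apply: opnorm_eq0; rewrite -E_isometric// Ew opnorm0.
have r0 : re_op (0 : bop H) = 0 by rewrite /re_op adjoint0 addr0 scaler0.
have i0 : im_op (0 : bop H) = 0 by rewrite /im_op adjoint0 subr0 !scaler0.
have re0 : re_op (y - z) = 0.
  apply: zero; [exact: (subspace_re Nlin)|exact: selfadjoint_re|].
  by rewrite (pu_re Nlin N1 E_pu)// Ed.
have im0 : im_op (y - z) = 0.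
  apply: zero; [exact: (subspace_im Nlin)|exact: selfadjoint_im|].
  by rewrite (pu_im Nlin N1 E_pu)// Ed.
by rewrite [LHS]re_imE re0 im0 scaler0 addr0.
Qed.

(** A unital isometry reflects positivity, because [0 <= x <= m] can be read off
    from norms. *)
Lemma E_reflects_positive y : N y -> positive_op (E y) -> positive_op y.
Proof.
move=> Ny Ey0.
have ysa : selfadjoint y.
  apply: E_inj; rewrite ?inE//; first exact: Nadj.
  by rewrite (pu_adjoint Nlin N1 E_pu)//; [exact: positive_selfadjoint|exact: Nadj].
have [m m0 ym] : exists2 m, 0 < m & opnorm (E y) <= m.
  by exists (opnorm (E y) + 1); rewrite ?lerDl// ltr_wpDl ?opnorm_ge0.
have Nm : N m%:S by exact: (subspaceZ Nlin).
have dsa : selfadjoint (m%:S - y).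
  by apply: selfadjointB => //; apply/selfadjointZ/selfadjoint1.
have h : opnorm (m%:S - y) <= m.
  rewrite -E_isometric//; last exact: (subspaceB Nlin).
  rewrite (linear_onB Nlin E_lin)// (pu_scalar Nlin N1 E_pu).
  have mE := positive_opnorm (positive_selfadjoint Ey0) ym.
  apply: opnorm_le_positive => //; first by rewrite opprB addrC subrK.
  by apply: positiveD => //; apply: positiveZ (ltW m0) positive1.
by have := positive_opnorm dsa h; rewrite opprB addrC subrK.
Qed.

(** If the tail system is a Jordan algebra, Kadison's inequality holds on it both
    for [phi] and for its positive inverse [E \o beta \o E^-1], which makes it an
    equality. *)
Lemma tail_sub_core : jordan_subalgebra M T -> T `<=` multiplicative_core M phi.
Proof.
move=> [TM Tlin Tjordan].
have TE x : T x -> exists2 y, N y & E y = x by exact: tail_sub_E.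
pose F := 'pinv_(fun=> 0) N E.
have FK y : N y -> F (E y) = y by move=> Ny; apply: pinvKV E_inj _ _; rewrite inE.
pose theta x := E (beta (F x)).
have T1 : T 1 by have [_ <- _] := E_pu; exact: E_tail.
have thetaE y : N y -> theta (E y) = E (beta y) by move=> Ny; rewrite /theta FK.
have theta_pu : positive_unital T theta.
  split.
  - move=> a _ _ /TE[y Ny <-] /TE[z Nz <-].
    have Nyz : N (a *: y + z).
      by apply: (subspaceD Nlin) => //; exact: (subspaceZ Nlin).
    rewrite -E_lin// !thetaE// beta_lin// E_lin//; exact: N_beta.
  - by have [_ e _] := E_pu; rewrite -e thetaE//; have [_ -> _] := beta_pu.
  - move=> _ /TE[y Ny <-] Ey0; rewrite thetaE//.
    case: E_pu => _ _; apply; first exact: N_beta.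
    by case: beta_pu => _ _; apply => //; exact: E_reflects_positive.
have phi_theta x : T x -> phi (theta x) = x.
  by move=> /TE[y Ny <-]; rewrite thetaE// -E_alpha ?betaK//; exact: N_beta.
have theta_phi x : T x -> theta (phi x) = x.
  by move=> /TE[y Ny <-]; rewrite -E_alpha// thetaE ?alphaK//; exact: N_alpha.
have Tphi x : T x -> T (phi x).
  by move=> /TE[y Ny <-]; rewrite -E_alpha//; exact/E_tail/N_alpha.
have Ttheta x : T x -> T (theta x).
  by move=> /TE[y Ny <-]; rewrite thetaE//; exact/E_tail/N_beta.
have TX x n : T x -> T (x ^+ n).
  by move=> Tx; elim: n => // n IH; rewrite -jordan_exp; exact: Tjordan.
have [phi_lin phi_1 phi_pos] := UP_pu phi_UP.
have def_sa x : T x -> selfadjoint x -> definite_set M phi x.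
  move=> Tx xsa; have Mx := TM _ Tx; split=> //.
  have psa : selfadjoint (phi x).
    by apply: (pu_selfadjoint Mlin M1 (UP_pu phi_UP)).
  rewrite xsa psa !jordan_sq.
  apply/eqP; rewrite -subr_eq0; apply/eqP; apply: positive_le0_eq0.
    exact: (phi_kadison M_vna phi_UP).
  have := kadison Tlin T1 theta_pu (fun h Th _ n => TX h n Th) (Tphi _ Tx) psa.
  rewrite theta_phi// => h.
  have Tt : T (theta (phi x ^+ 2)) by apply: Ttheta; apply: TX; exact: Tphi.
  have := phi_pos _ (TM _ (subspaceB Tlin Tt (TX x 2 Tx))) h.
  rewrite (linear_onB Mlin phi_lin); [|exact: TM|exact/TM/TX].
  by rewrite phi_theta ?opprB//; apply: TX; exact: Tphi.
have def x : T x -> definite_set M phi x.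
  move=> Tx; have Ta := tail_adjoint Tx.
  have Dlin := definite_set_lin M_vna phi_UP.
  rewrite [x]re_imE; apply: (subspaceD Dlin).
    by apply: def_sa; [exact: (subspace_re Tlin)|exact: selfadjoint_re].
  apply: (subspaceZ Dlin).
  by apply: def_sa; [exact: (subspace_im Tlin)|exact: selfadjoint_im].
have Titer n x : T x -> T (iter n phi x).
  by move=> Tx; elim: n => // n IH /=; exact: Tphi.
move=> x Tx n _; have [y Ny yx] := TE x Tx.
exists (E (iter n beta y)); last by rewrite iter_phi_E_beta.
have Ty : T (E (iter n beta y)) by exact/E_tail/N_iter_beta.
by split; [exact: TM|move=> m; exact/def/Titer].
Qed.

End EmbeddedLift.

Theorem theorem4p2 (R : realType) (H : hilbertType R) (M : set (bop H))
    (phi : bop H -> bop H)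
    (M_vna : von_neumann_algebra M) (phi_UP : UP_map M M phi) :
  multiplicative_core M phi `<=` tail_system M phi /\
  (asymptotic_lift_embeds M phi ->
    (jordan_subalgebra M (tail_system M phi) <->
     tail_system M phi = multiplicative_core M phi)).
Proof.
have sub := multiplicative_core_tail M_vna phi_UP.
split=> // -[K [N [alpha [E [lift E_iso]]]]]; split=> [tJ|->].
  by apply/seteqP; split=> //; exact: (tail_sub_core M_vna phi_UP lift E_iso tJ).
exact: multiplicative_core_jordan.
Qed.
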